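(* Let $\varphi$ be a strongly convex function that satisfies the $\Delta_2$-condition and the $\nabla_2$-condition. If $u$ is a non-negative Borel function on the unit disk $\mathbb{D}$, then the following are equivalent: (a) There exists a function $w\in L^\varphi(\mathbb{T})$ such that $u(z)\le P[w](z)$ for all $z\in\mathbb{D}$. (b) There exists a constant $C\ge0$ such that $\sup_{\mu\in\mathcal{B}_{\varphi^*}}\int u(z)\,d\mu(z)\le C$, where $\mathcal{B}_{\varphi^*}$ is the set of positive measures $\mu$ on $\mathbb{D}$ with $\|B(\mu)\|_{(L^\varphi)^*}\le1$.
   Context: A function $\varphi:\mathbb{R}\to[0,\infty)$ is strongly convex if it is convex, nondecreasing, $\lim_{t\to\infty}\varphi(t)/t=\infty$, and there are constants $M,K\ge0$, $t_0\in\mathbb{R}$ with $\varphi(t+2)\le M\varphi(t)+K$ for $t\ge t_0$. $\Delta_2$-condition: there are $c\ge1$, $t_0$ with $\varphi(a+b)\le c(\varphi(a)+\varphi(b))$ for all $a,b\ge t_0$. $\nabla_2$-condition: there are $d>1$, $t_0>0$ with $2\varphi(t)\le\frac1d\varphi(dt)$ for $t\ge t_0$. $L^\varphi(\mathbb{T})$ is the Orlicz space of measurable $u$ on $\mathbb{T}$ with $\varphi\circ|u|\in L^1(m)$ ($m$ normalized Lebesgue measure); $\varphi$ is modified on some $[0,t_0]$ to a convex function on $[0,\infty)$ vanishing at $0$, $L^\varphi$ carries the Banach norm $\|u\|_\varphi=\inf\{t>0:\int\varphi(|u|/t)dm\le t\}$, and $(L^\varphi)^*$ is its dual with dual norm.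 $P_z(\zeta)=\frac{1-|z|^2}{|\zeta-z|^2}$, $P[w](z)=\int_{\mathbb{T}}P_z w\,dm$. The Poisson balayage of a finite positive measure $\mu$ is $B(\mu)(\zeta)=\int_{\mathbb{D}}P_z(\zeta)\,d\mu(z)$, $\zeta\in\mathbb{T}$. *)

(* Defs.v *)
From HB Require Import structures.
From mathcomp Require Import all_boot all_order all_algebra.
From mathcomp Require Import all_classical all_reals all_analysis.
Set Implicit Arguments. Unset Strict Implicit. Unset Printing Implicit Defensive.
Import Order.TTheory GRing.Theory Num.Theory.
Import numFieldNormedType.Exports.
Local Open Scope classical_set_scope.
Local Open Scope ring_scope.

(* The unit disk D, as a subset of R x R (z = x + i y  <->  (x, y)). *)
Definition unit_disk (R : realType) : set (R * R) :=
  [set z | z.1 ^+ 2 + z.2 ^+ 2 < 1].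
Arguments unit_disk R : clear implicits.

(* Poisson kernel P_z(zeta) for zeta = e^{i theta} on T. *)
Definition poisson_kernel (R : realType) (z : R * R) (theta : R) : R :=
  (1 - (z.1 ^+ 2 + z.2 ^+ 2)) /
  ((cos theta - z.1) ^+ 2 + (sin theta - z.2) ^+ 2).

(* The circle T is parametrized by theta in [0, 2 pi[ ; m = normalized
   Lebesgue measure, i.e. dm = dtheta / (2 pi). *)
Definition Tint (R : realType) (f : R -> \bar R) : \bar R :=
  (((2 * pi) ^-1)%:E *
   \int[lebesgue_measure]_(t in `[0%R, (2 * pi)%R[) f t)%E.

Definition poisson_int (R : realType) (w : R -> R) (z : R * R) : \bar R :=
  Tint (fun t => (poisson_kernel z t * w t)%:E).

Definition balayage (R : realType) (mu : {measure set (R * R) -> \bar R})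
  (theta : R) : \bar R :=
  (\int[mu]_(z in unit_disk R) (poisson_kernel z theta)%:E)%E.

Definition convex_on_R (R : realType) (phi : R -> R) : Prop :=
  forall x y l : R, 0 <= l <= 1 ->
    phi (l * x + (1 - l) * y) <= l * phi x + (1 - l) * phi y.

Definition strongly_convex (R : realType) (phi : R -> R) : Prop :=
  [/\ (forall t, 0 <= phi t),
      convex_on_R phi,
      {homo phi : x y / x <= y},
      (fun t => phi t / t) @ +oo --> +oo &
      exists M K t0 : R, [/\ 0 <= M, 0 <= K &
        forall t, t0 <= t -> phi (t + 2) <= M * phi t + K]].

Definition Delta2 (R : realType) (phi : R -> R) : Prop :=
  exists c t0 : R, 1 <= c /\
    forall a b, t0 <= a -> t0 <= b -> phi (a + b) <= c * (phi a + phi b).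

Definition Nabla2 (R : realType) (phi : R -> R) : Prop :=
  exists d t0 : R, [/\ 1 < d, 0 < t0 &
    forall t, t0 <= t -> 2 * phi t <= d^-1 * phi (d * t)].

Definition orlicz_modification (R : realType) (phi psi : R -> R) : Prop :=
  [/\ exists t0 : R, forall t, t0 <= t -> psi t = phi t,
      psi 0 = 0,
      (forall t, 0 <= t -> 0 <= psi t) &
      (forall x y l : R, 0 <= x -> 0 <= y -> 0 <= l <= 1 ->
         psi (l * x + (1 - l) * y) <= l * psi x + (1 - l) * psi y)].

Definition in_orlicz (R : realType) (phi : R -> R) (w : R -> R) : Prop :=
  measurable_fun `[0%R, (2 * pi)%R[ w /\
  (Tint (fun t => (phi `|w t|)%:E) < +oo)%E.

Definition orlicz_norm (R : realType) (psi : R -> R) (w : R -> R) : \bar R :=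
  ereal_inf [set t%:E | t in [set t : R | 0 < t /\
     (Tint (fun s => (psi (`|w s| / t))%:E) <= t%:E)%E]].

(* ||B(mu)||_{(L^phi)^*} <= 1, for the functional w |-> int w B(mu) dm *)
Definition dual_norm_le1 (R : realType) (phi psi : R -> R)
  (mu : {measure set (R * R) -> \bar R}) : Prop :=
  forall w : R -> R, in_orlicz phi w -> (orlicz_norm psi w <= 1)%E ->
    (Tint (fun t => (`|w t|)%:E * balayage mu t) <= 1)%E.

Definition B_phistar (R : realType) (phi psi : R -> R)
  (mu : {measure set (R * R) -> \bar R}) : Prop :=
  [/\ mu (~` unit_disk R) = 0%E, (mu setT < +oo)%E & dual_norm_le1 phi psi mu].

(* Main.v *)
Require Import Defs.
From HB Require Import structures.
From mathcomp Require Import all_boot all_order all_algebra.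
From mathcomp Require Import all_classical all_reals all_analysis.
From mathcomp Require Import measurable_realfun.
From mathcomp Require Import ring lra.
Import Order.TTheory GRing.Theory Num.Theory.
Import numFieldNormedType.Exports.
Set Implicit Arguments. Unset Strict Implicit. Unset Printing Implicit Defensive.
Local Open Scope classical_set_scope.
Local Open Scope ring_scope.

(** (a) implies (b) by Tonelli's theorem, after scaling [w] to Orlicz norm at
    most 1.

    For the converse, let [K] be the convex set of measurable [w >= 0] on the
    circle whose [psi]-modular is at most 1. Testing (b) on finitely supported
    measures and separating convex sets in finite dimension, one gets for every
    finite set of points of the disk and every [e > 0] some [w] in [K] with
    [u - e <= C P[w]] at these points. These approximate solutions form nested
    convex sets [A s]. Near-minimisers of the strictly convex functional
    [J w = int exp (- w)] over [A s] converge almost everywhere along a sequence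
    [S n] that exhausts [sup_s inf_(A s) J], and adding one more point [z] to
    every [S n] does not change the limit [w]. Since [psi] is superlinear, [K]
    is uniformly integrable, so the inequality passes to the limit at every [z].
    Fatou's lemma bounds the modular of [w / 2], and the Delta_2-condition then
    puts all multiples of [w] in the Orlicz space. *)

(** * Separation of convex sets in finite dimension *)

(** [Q g] is the squared distance from [v] to the vectors lying below [g] on [s]. If its infimum [d]
    over [S] is positive, the positive part [a] of [v - g0] at a near-minimiser [g0] is a
    nonnegative separating weight: the dual hypothesis for [a] yields a direction in [S] along which
    [Q] falls below [d]. Near-minimisers suffice, so no minimum has to be attained. *)
Lemma convex_separation (R : realType) (X : eqType) (S : set (X -> R))
    (v : X -> R) (s : seq X) (B : R) :
  S !=set0 ->
  (forall g h l, S g -> S h -> 0 <= l <= 1 ->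
     S (fun x => l * g x + (1 - l) * h x)) ->
  (forall g h, S g -> S h -> \sum_(x <- s) (g x - h x) ^+ 2 <= B) ->
  (forall a : X -> R, (forall x, 0 <= a x) -> forall e, 0 < e ->
     exists2 g, S g &
       \sum_(x <- s) a x * v x <= \sum_(x <- s) a x * g x + e) ->
  forall e, 0 < e -> exists2 g, S g & forall x, x \in s -> v x - e <= g x.
Proof.
move=> [g1 Sg1] Sconv SB Sdual e e0.
pose Q (g : X -> R) := \sum_(x <- s) Num.max 0 (v x - g x) ^+ 2.
pose d := inf [set Q g | g in S].
have Qge0 g : 0 <= Q g by apply: sumr_ge0 => x _; exact: sqr_ge0.
have Qinf : has_inf [set Q g | g in S].
  split; first by exists (Q g1), g1.
  by exists 0 => _ [g _ <-].
have dle g : S g -> d <= Q g.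
  by move=> Sg; apply: ge_inf; [case: Qinf | exists g].
have B0 : 0 <= B.
  by apply: le_trans (SB _ _ Sg1 Sg1); apply: sumr_ge0 => x _; exact: sqr_ge0.
have [d0|d0] := leP d 0.
  have e20 : 0 < e ^+ 2 by rewrite exprn_gt0.
  have [_ [g Sg <-] Qg] := inf_adherent e20 Qinf.
  exists g => // x xs; rewrite -/d in Qg.
  have : Num.max 0 (v x - g x) ^+ 2 < e ^+ 2.
    apply: (le_lt_trans _ (lt_le_trans Qg _)); last by rewrite gerDr.
    rewrite /Q (big_rem x)//= lerDl; apply: sumr_ge0 => y _; exact: sqr_ge0.
  rewrite ltr_sqr ?nnegrE ?le_max ?lexx//; last exact: ltW.
  by rewrite gt_max => /andP[_ ?]; lra.
(* With this step length, the first-order gain [t * d] covers both the second-order error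
   [t ^+ 2 * B] and the slack [t ^+ 2] of the near-minimiser. *)
pose t := Num.min 1 (d / (1 + B)).
have B1 : 0 < 1 + B by rewrite ltr_wpDr.
have t0 : 0 < t by rewrite lt_min ltr01 divr_gt0.
have t1 : t <= 1 by rewrite ge_min lexx.
have tB : t * (1 + B) <= d.
  by rewrite -ler_pdivlMr// ge_min lexx orbT.
have t20 : 0 < t ^+ 2 by rewrite exprn_gt0.
have [_ [g0 Sg0 <-] Qg0] := inf_adherent t20 Qinf; rewrite -/d in Qg0.
pose a x := Num.max 0 (v x - g0 x).
have a0 x : 0 <= a x by rewrite le_max lexx.
have d20 : 0 < d / 2 by rewrite divr_gt0.
have [g Sg avg] := Sdual a a0 _ d20; exfalso.
pose gt x := t * g x + (1 - t) * g0 x.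
have Sgt : S gt by apply: Sconv => //; rewrite (ltW t0).
(* Since [v x - g0 x <= a x], the positive part of [v x - gt x] is at most [a x - t * (g x - g0 x)]
   in absolute value; squaring gives the expansion. *)
have Qgt : Q gt <= Q g0 - 2 * t * \sum_(x <- s) a x * (g x - g0 x)
   + t ^+ 2 * \sum_(x <- s) (g x - g0 x) ^+ 2.
  rewrite /Q !mulr_sumr -sumrB -big_split/= ler_sum// => x _.
  rewrite -/(a x).
  have -> : a x ^+ 2 - 2 * t * (a x * (g x - g0 x)) + t ^+ 2 * (g x - g0 x) ^+ 2
    = (a x - t * (g x - g0 x)) ^+ 2 by ring.
  have ax : v x - g0 x <= a x by rewrite le_max lexx orbT.
  have gtx : v x - gt x <= a x - t * (g x - g0 x) by rewrite /gt; lra.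
  rewrite maxEle; case: ifP => [h|_]; last by rewrite expr0n/=; exact: sqr_ge0.
  by rewrite ler_sqr// nnegrE// (le_trans h).
have av : \sum_(x <- s) a x * v x = \sum_(x <- s) a x * g0 x + Q g0.
  rewrite /Q -big_split/=; apply: eq_bigr => x _; rewrite -/(a x).
  have [h|h] := leP 0 (v x - g0 x).
    have -> : a x = v x - g0 x by rewrite /a max_r.
    by ring.
  have -> : a x = 0 by rewrite /a max_l// ltW.
  by ring.
have ag : \sum_(x <- s) a x * (g x - g0 x) =
    \sum_(x <- s) a x * g x - \sum_(x <- s) a x * g0 x.
  by rewrite -sumrB; apply: eq_bigr => x _; rewrite mulrBr.
have := dle _ Sgt; have := dle _ Sg0; have := SB _ _ Sg Sg0.
move: Qgt avg; rewrite ag av.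
set U := \sum_(x <- s) a x * g x; set W := \sum_(x <- s) a x * g0 x.
set V := \sum_(x <- s) (_ - _) ^+ 2 => Qgt avg VB dg0 dgt.
have : t ^+ 2 * V <= t ^+ 2 * B by apply: ler_wpM2l => //; exact: ltW.
have : t * (U - W) >= t * (d / 2) by apply: ler_wpM2l; [exact: ltW | lra].
have : t * (t * (1 + B)) <= t * d by apply: ler_wpM2l => //; exact: ltW.
nra.
Qed.

(** * Convex gauges on the half-line *)

Section convex_gauge.
Variables (R : realType) (psi : R -> R).
Hypothesis psi0 : psi 0 = 0.
Hypothesis psi_ge0 : forall t : R, 0 <= t -> 0 <= psi t.
Hypothesis psi_convex : forall x y l : R, 0 <= x -> 0 <= y -> 0 <= l <= 1 ->
  psi (l * x + (1 - l) * y) <= l * psi x + (1 - l) * psi y.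

Lemma gauge_scale l x : 0 <= l <= 1 -> 0 <= x -> psi (l * x) <= l * psi x.
Proof.
move=> l01 x0; have := psi_convex x0 (lexx 0) l01.
by rewrite !mulr0 !addr0 psi0 mulr0 addr0.
Qed.

(** [x] is the multiple [x / y] of [y], so [gauge_scale] bounds [psi x] by [x / y * psi y]. *)
Lemma gauge_le x y : 0 <= x -> x <= y -> psi x <= psi y.
Proof.
move=> x0 xy; have y0 := le_trans x0 xy.
have [y00|y_neq0] := eqVneq y 0.
  by have -> : x = y by apply/eqP; rewrite eq_le xy y00.
have yp : 0 < y by rewrite lt_def y_neq0.
have l01 : 0 <= x / y <= 1 by rewrite divr_ge0//= ler_pdivrMr// mul1r.
have /andP[_ l1] := l01.
have -> : x = x / y * y by rewrite divfK.
apply: (le_trans (gauge_scale l01 y0)).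
by rewrite -[leRHS]mul1r ler_wpM2r// psi_ge0.
Qed.

(** [psi] is controlled only on nonnegative arguments. Precomposing it with [Num.max 0] gives a
    nondecreasing, hence measurable, function on the whole line. *)
Lemma gauge_measurable d (T : measurableType d) (D : set T) (w : T -> R) :
  measurable_fun D w -> (forall t, 0 <= w t) ->
  measurable_fun D (fun t => psi (w t)).
Proof.
move=> mw w0.
have -> : (fun t => psi (w t)) = (fun x => psi (Num.max 0 x)) \o w.
  by apply/funext => t /=; rewrite max_r.
apply: measurableT_comp => //; apply: nondecreasing_measurable => // x y xy.
apply: gauge_le; first by rewrite le_max lexx.
by rewrite ge_max !le_max lexx xy orbT.
Qed.

End convex_gauge.

(** * Domination and almost everywhere convergence of series *)

Section finite_measure_integrals.
Context d (T : measurableType d) (R : realType).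
Variables (mu : {measure set T -> \bar R}) (D : set T).
Hypothesis mD : measurable D.

Lemma integrable_dominated (f g : T -> R) : measurable_fun D f ->
  (forall t, D t -> `|f t| <= g t) -> mu.-integrable D (EFin \o g) ->
  mu.-integrable D (EFin \o f).
Proof.
move=> mf fg; apply: le_integrable => //; first exact/measurable_EFinP.
move=> t Dt /=; rewrite lee_fin; apply: (le_trans (fg _ Dt)).
exact: ler_norm.
Qed.

Lemma integrable_bounded (f : T -> R) M : (mu D < +oo)%E ->
  measurable_fun D f -> (forall t, D t -> `|f t| <= M) ->
  mu.-integrable D (EFin \o f).
Proof.
move=> muD mf fM; apply: measurable_bounded_integrable => //.
exists M; split; first exact: num_real.
by move=> x Mx t Dt; apply: le_trans (fM _ Dt) _; exact: ltW.
Qed.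

(** The integral of the sum is at most [2 * c], so the sum is finite almost everywhere. *)
Lemma ae_cvg_series (g : nat -> T -> R) (c : R) :
  (forall n, measurable_fun D (g n)) -> (forall n t, D t -> 0 <= g n t) ->
  (forall n, (\int[mu]_(t in D) (g n t)%:E <= (c * 2^-1 ^+ n)%:E)%E) ->
  {ae mu, forall t, D t -> cvgn (series (g ^~ t))}.
Proof.
move=> mg g0 gc.
have c0 : 0 <= c.
  have := le_trans (integral_ge0 _ _) (gc 0%N); rewrite expr0 mulr1 lee_fin.
  by apply=> t Dt; rewrite lee_fin g0.
have mEg n : measurable_fun D (fun t => (g n t)%:E) by exact/measurable_EFinP.
have intS : mu.-integrable D (fun t => \sum_(n <oo) (g n t)%:E)%E.
  apply/integrableP; split.
    apply: (emeasurable_fun_cvg (fun n t => \sum_(0 <= i < n) (g i t)%:E)%E).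
      by move=> n; exact: emeasurable_sum.
    by move=> t Dt; apply: is_cvg_nneseries => n _ _; rewrite lee_fin g0.
  rewrite (eq_integral (fun t => \sum_(n <oo) (g n t)%:E)%E); last first.
    move=> t; rewrite inE => Dt; rewrite gee0_abs//.
    by apply: nneseries_ge0 => n _ _; rewrite lee_fin g0.
  rewrite integral_nneseries//.
  apply: (@le_lt_trans _ _ (2 * c)%:E); last exact: ltry.
  apply: lime_le.
    apply: is_cvg_nneseries => n _ _; apply: integral_ge0 => t Dt.
    by rewrite lee_fin g0.
  apply: nearW => n.
  apply: (@le_trans _ _ (\sum_(0 <= i < n) (c * 2^-1 ^+ i)%:E)%E).
    exact: lee_sum.
  rewrite sumEFin lee_fin.
  have -> : \sum_(0 <= i < n) c * 2^-1 ^+ i = 2 * c - 2 * c * 2^-1 ^+ n.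
    elim: n => [|n ih]; first by rewrite big_geq// expr0; ring.
    by rewrite big_nat_recr//= ih exprS; field.
  by rewrite gerBl !mulr_ge0// exprn_ge0// invr_ge0.
have := integrable_ae mD intS; apply: filterS => t /= fint Dt.
have {}fint := fint Dt.
apply: nondecreasing_is_cvgn.
  apply/nondecreasing_seqP => n.
  by rewrite /series/= big_nat_recr//= lerDl g0.
exists (fine (\sum_(n <oo) (g n t)%:E)%E) => _ [n _ <-].
rewrite -lee_fin fineK// /series/= -sumEFin.
by apply: nneseries_lim_ge => i _; rewrite lee_fin g0.
Qed.

End finite_measure_integrals.

(** * The unit ball of the modular and its uniform integrability *)

Section orlicz_ball.
Context d (T : measurableType d) (R : realType).
Variables (mu : {measure set T -> \bar R}) (D : set T).
Hypotheses (mD : measurable D) (muD : (mu D < +oo)%E).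
Variable psi : R -> R.
Hypothesis psi0 : psi 0 = 0.
Hypothesis psi_ge0 : forall t : R, 0 <= t -> 0 <= psi t.
Hypothesis psi_convex : forall x y l : R, 0 <= x -> 0 <= y -> 0 <= l <= 1 ->
  psi (l * x + (1 - l) * y) <= l * psi x + (1 - l) * psi y.
Hypothesis psi_superlinear : forall e : R, 0 < e -> exists L : R, forall t : R,
  0 <= t -> L <= t -> t <= e * psi t.

(** The constraint is on the modular rather than the norm, so that convexity comes directly from
    [psi]. Nonnegativity is asked on all of [T], which keeps the arguments of [psi] in the range
    where it is controlled. *)
Definition orlicz_ball : set (T -> R) :=
  [set w : T -> R | [/\ measurable_fun D w, forall t, 0 <= w t &
     (\int[mu]_(t in D) (psi (w t))%:E <= 1)%E]].

Let mpsi w : orlicz_ball w -> measurable_fun D (fun t => psi (w t)).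
Proof. by case=> mw w0 _; exact: gauge_measurable. Qed.

Lemma orlicz_ball_gauge_integrable w : orlicz_ball w ->
  mu.-integrable D (EFin \o (fun t => psi (w t))).
Proof.
move=> Kw; have [mw w0 w1] := Kw.
apply/integrableP; split; first exact/measurable_EFinP/mpsi.
under eq_integral => t _ do rewrite /= ger0_norm ?psi_ge0//.
exact: le_lt_trans w1 (ltry _).
Qed.

Lemma orlicz_ball_gauge_le1 w : orlicz_ball w ->
  \int[mu]_(t in D) psi (w t) <= 1.
Proof.
move=> Kw; have [mw w0 w1] := Kw.
rewrite -lee_fin fineK//.
exact: (integrable_fin_num mD (orlicz_ball_gauge_integrable Kw)).
Qed.

Lemma orlicz_ball0 : orlicz_ball (fun=> 0).
Proof.
split=> //; under eq_integral do rewrite psi0.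
by rewrite integral0.
Qed.

Lemma orlicz_ball_convex w y l : orlicz_ball w -> orlicz_ball y ->
  0 <= l <= 1 -> orlicz_ball (fun t => l * w t + (1 - l) * y t).
Proof.
move=> Kw Ky l01; have [mw w0 w1] := Kw; have [my y0 y1] := Ky.
have /andP[l0 l1] := l01.
have mc : measurable_fun D (fun t => l * w t + (1 - l) * y t).
  by apply: measurable_funD; apply: measurable_funM.
have c0 t : 0 <= l * w t + (1 - l) * y t.
  by rewrite addr_ge0// mulr_ge0// subr_ge0.
have mcp : measurable_fun D (fun t => psi (l * w t + (1 - l) * y t)).
  exact: (gauge_measurable psi0 psi_ge0 psi_convex mc c0).
have iw := orlicz_ball_gauge_integrable Kw.
have iy := orlicz_ball_gauge_integrable Ky.
have ilw : mu.-integrable D (EFin \o (fun t => l * psi (w t))).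
  by apply: (integrableZl mD l iw).
have ily : mu.-integrable D (EFin \o (fun t => (1 - l) * psi (y t))).
  by apply: (integrableZl mD (1 - l) iy).
split=> //.
apply: (@le_trans _ _
  (\int[mu]_(t in D) (l * psi (w t) + (1 - l) * psi (y t)))%:E).
  rewrite fineK; last first.
    by apply: integrable_fin_num => //; exact: (integrableD mD ilw ily).
  apply: ge0_le_integral => //.
  - by move=> t Dt; rewrite lee_fin psi_ge0.
  - exact/measurable_EFinP.
  - by have /integrableP[] := integrableD mD ilw ily.
  - by move=> t Dt; rewrite lee_fin psi_convex.
rewrite RintegralD// !RintegralZl// lee_fin.
have := orlicz_ball_gauge_le1 Kw; have := orlicz_ball_gauge_le1 Ky.
set a := \int[_]_(_ in _) _; set b := \int[_]_(_ in _) _ => a1 b1.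
have : l * b <= l * 1 by apply: ler_wpM2l.
have : (1 - l) * a <= (1 - l) * 1 by apply: ler_wpM2l => //; rewrite subr_ge0.
lra.
Qed.

(** Superlinearity with [e = 1] gives [w <= max 0 L + psi w] pointwise. Integrating the same
    inequality gives the uniform bound of [orlicz_ball_integral_le]. *)
Lemma orlicz_ball_integrable w : orlicz_ball w ->
  mu.-integrable D (EFin \o w).
Proof.
move=> Kw; have [mw w0 w1] := Kw.
have [L hL] := psi_superlinear ltr01.
apply: (@integrable_dominated _ _ _ mu D mD _
  (fun t => Num.max 0 L + psi (w t))) => //.
  move=> t Dt; rewrite ger0_norm//.
  have [Lw|Lw] := leP L (w t).
    by have := hL _ (w0 t) Lw; rewrite mul1r => h; rewrite (le_trans h)// lerDr le_max lexx.
  rewrite (le_trans (ltW Lw))// -[leLHS]addr0 lerD// ?psi_ge0//.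
  by rewrite le_max lexx orbT.
have iL : mu.-integrable D (EFin \o (fun=> Num.max 0 L)).
  by apply: (@integrable_bounded _ _ _ mu D mD (fun=> Num.max 0 L) `|Num.max 0 L|).
exact: (integrableD mD iL (orlicz_ball_gauge_integrable Kw)).
Qed.

Lemma orlicz_ball_integral_le : exists B, 0 <= B /\
  forall w, orlicz_ball w -> \int[mu]_(t in D) w t <= B.
Proof.
have [L hL] := psi_superlinear ltr01.
have iL : mu.-integrable D (EFin \o (fun=> Num.max 0 L)).
  by apply: (@integrable_bounded _ _ _ mu D mD (fun=> Num.max 0 L) `|Num.max 0 L|).
have IL0 : 0 <= \int[mu]_(t in D) Num.max 0 L.
  by apply: Rintegral_ge0 => t _; rewrite le_max lexx.
exists (\int[mu]_(t in D) Num.max 0 L + 1); split=> [|w Kw].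
  by rewrite addr_ge0.
have [mw w0 w1] := Kw.
have iw := orlicz_ball_gauge_integrable Kw.
apply: (le_trans _ (lerD (lexx _) (orlicz_ball_gauge_le1 Kw))).
rewrite -RintegralD//; apply: le_Rintegral => //.
- exact: orlicz_ball_integrable.
- exact: (integrableD mD iL iw).
move=> t Dt; have [Lw|Lw] := leP L (w t).
  by have := hL _ (w0 t) Lw; rewrite mul1r => h; rewrite (le_trans h)// lerDr le_max lexx.
rewrite (le_trans (ltW Lw))// -[leLHS]addr0 lerD// ?psi_ge0//.
by rewrite le_max lexx orbT.
Qed.

Variables (k : T -> R) (M : R).
Hypotheses (mk : measurable_fun D k) (k0 : forall t, 0 <= k t)
  (kM : forall t, k t <= M).

Lemma orlicz_ball_kernel_integrable w : orlicz_ball w ->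
  mu.-integrable D (EFin \o (fun t => k t * w t)).
Proof.
move=> Kw; have [mw w0 w1] := Kw.
apply: (@integrable_dominated _ _ _ mu D mD _ (fun t => M * w t)) => //.
- exact: measurable_funM.
- by move=> t Dt; rewrite ger0_norm ?mulr_ge0// ler_wpM2r.
- exact: (integrableZl mD M (orlicz_ball_integrable Kw)).
Qed.

Lemma orlicz_ball_kernel_convex w y l : orlicz_ball w -> orlicz_ball y ->
  \int[mu]_(t in D) (k t * (l * w t + (1 - l) * y t)) =
  l * \int[mu]_(t in D) (k t * w t) + (1 - l) * \int[mu]_(t in D) (k t * y t).
Proof.
move=> Kw Ky.
have iw := orlicz_ball_kernel_integrable Kw.
have iy := orlicz_ball_kernel_integrable Ky.
rewrite -!RintegralZl// -RintegralD//.
- by apply: eq_Rintegral => t _; ring.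
- exact: (integrableZl mD l iw).
- exact: (integrableZl mD (1 - l) iy).
Qed.

(** Uniform integrability of the ball: where [w] is at least the level, [k * w <= M * e * psi w],
    and the modular is at most 1. The level [L] does not depend on [w]. *)
Lemma orlicz_ball_kernel_truncate e : 0 < e -> exists2 L, 0 <= L &
  forall w, orlicz_ball w -> \int[mu]_(t in D) (k t * w t) <=
     \int[mu]_(t in D) (k t * Num.min (w t) L) + M * e.
Proof.
move=> e0; have [L hL] := psi_superlinear e0.
exists (Num.max 0 L); first by rewrite le_max lexx.
move=> w Kw; have [mw w0 w1] := Kw.
set L' := Num.max 0 L; have L0 : 0 <= L' by rewrite le_max lexx.
have M0 : 0 <= M by apply: le_trans (k0 point) (kM point).
have iw := orlicz_ball_kernel_integrable Kw.
have im : mu.-integrable D (EFin \o (fun t => k t * Num.min (w t) L')).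
  apply: (integrable_dominated mD _ _ iw).
    by apply: measurable_funM => //; exact: measurable_minr.
  move=> t Dt; rewrite ger0_norm ?mulr_ge0// ?le_min ?w0//.
  by rewrite ler_wpM2l// ge_min lexx.
have ip := orlicz_ball_gauge_integrable Kw.
have iMp : mu.-integrable D (EFin \o (fun t => M * e * psi (w t))).
  exact: (integrableZl mD (M * e) ip).
have Mp1 : \int[mu]_(t in D) (M * e * psi (w t)) <= M * e.
  rewrite RintegralZl// ler_piMr ?mulr_ge0// ?(ltW e0)//.
  exact: orlicz_ball_gauge_le1.
apply: (le_trans _ (lerD (lexx _) Mp1)).
rewrite -RintegralD//; apply: le_Rintegral => //.
  exact: (integrableD mD im iMp).
move=> t Dt.
have p0 := psi_ge0 (w0 t).
have [Lw|Lw] := leP L' (w t).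
  have hw : w t <= e * psi (w t).
    by apply: hL => //; apply: le_trans Lw; rewrite le_max lexx orbT.
  have : k t * w t <= M * (e * psi (w t)) by apply: ler_pM.
  have : 0 <= k t * L' by rewrite mulr_ge0.
  lra.
have : 0 <= M * e * psi (w t) by rewrite !mulr_ge0// ltW.
lra.
Qed.

End orlicz_ball.

(** * Limits of near-minimisers over nested convex sets *)

Section forward_limit.
Context d (T : measurableType d) (R : realType).
Variables (mu : {measure set T -> \bar R}) (D : set T).
Hypotheses (mD : measurable D) (muD : (mu D < +oo)%E).

Let nneg_measurable (w : T -> R) := measurable_fun D w /\ forall t, 0 <= w t.

Let J (w : T -> R) := \int[mu]_(t in D) expR (- w t).

Let mexp (c : R) w : nneg_measurable w ->
  measurable_fun D (fun t => expR (- (c * w t))).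
Proof.
case=> mw _; apply: measurableT_comp => //; apply: measurable_funN.
exact: measurable_funM.
Qed.

Let iexp w : nneg_measurable w ->
  mu.-integrable D (EFin \o (fun t => expR (- w t))).
Proof.
move=> nw; have [mw w0] := nw.
apply: (@integrable_bounded _ _ _ mu D mD _ 1) => //.
  by have := mexp 1 nw; under eq_fun do rewrite mul1r.
by move=> t _; rewrite ger0_norm ?expR_ge0// -expR0 ler_expR oppr_le0.
Qed.

Let half_dist (w y : T -> R) (t : T) : R :=
  `|expR (- (2^-1 * w t)) - expR (- (2^-1 * y t))|.

(* [exp] turns the parallelogram identity into
   [(e^(-a/2) - e^(-b/2))^2 = e^(-a) + e^(-b) - 2 e^(-(a+b)/2)],
   so near-minimisers of [J] over a convex set are close to each other. *)
Let half_dist_le (w y : T -> R) (j : R) n :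
  nneg_measurable w -> nneg_measurable y ->
  J w <= j + 4^-1 ^+ n -> J y <= j + 4^-1 ^+ n ->
  j - 4^-1 ^+ n <= J (fun t => 2^-1 * w t + (1 - 2^-1) * y t) ->
  (\int[mu]_(t in D) (half_dist w y t)%:E <=
   ((fine (mu D) + 4) * 2^-1 ^+ n)%:E)%E.
Proof.
move=> nw ny Jw Jy Jm.
have [mw w0] := nw; have [my y0] := ny.
pose m t := 2^-1 * w t + (1 - 2^-1) * y t.
have nm : nneg_measurable m.
  split; first by apply: measurable_funD; apply: measurable_funM.
  by move=> t; rewrite /m addr_ge0// mulr_ge0//; lra.
have iw := iexp nw; have iy := iexp ny; have im := iexp nm.
have mh : measurable_fun D (half_dist w y).
  by apply: measurableT_comp => //; apply: measurable_funB; exact: mexp.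
have h0 t : 0 <= half_dist w y t by exact: normr_ge0.
have ih : mu.-integrable D (EFin \o half_dist w y).
  apply: (@integrable_bounded _ _ _ mu D mD _ 2) => // t _.
  rewrite normr_id (le_trans (ler_normB _ _))//.
  have e1 (x : R) : 0 <= x -> `|expR (- (2^-1 * x))| <= 1.
    move=> x0; rewrite ger0_norm ?expR_ge0// -expR0 ler_expR oppr_le0.
    by rewrite mulr_ge0.
  by have := e1 _ (w0 t); have := e1 _ (y0 t); lra.
have hsq t : half_dist w y t ^+ 2 =
    expR (- w t) + expR (- y t) - 2 * expR (- m t).
  rewrite /half_dist real_normK ?num_real//.
  have -> : - w t = - (2^-1 * w t) + - (2^-1 * w t) by field.
  have -> : - y t = - (2^-1 * y t) + - (2^-1 * y t) by field.
  have -> : - m t = - (2^-1 * w t) + - (2^-1 * y t) by rewrite /m; field.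
  by rewrite !expRD; ring.
have i2m : mu.-integrable D (EFin \o (fun t => 2 * expR (- m t))).
  exact: (integrableZl mD 2 im).
have iwy : mu.-integrable D (EFin \o (fun t => expR (- w t) + expR (- y t))).
  exact: (integrableD mD iw iy).
have isq : mu.-integrable D (EFin \o (fun t => half_dist w y t ^+ 2)).
  under eq_fun do rewrite hsq.
  exact: (integrableB mD iwy i2m).
have sqle : \int[mu]_(t in D) half_dist w y t ^+ 2 <= 4 * 4^-1 ^+ n.
  under eq_Rintegral do rewrite hsq.
  rewrite RintegralB// RintegralD// RintegralZl//.
  move: Jw Jy Jm; rewrite -/m -/(J w) -/(J y) -/(J m); lra.
have p0 : 0 < 2^-1 ^+ n :> R by rewrite exprn_gt0.
have icst : mu.-integrable D (EFin \o (fun=> 2^-1 ^+ n : R)).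
  by apply: (@integrable_bounded _ _ _ mu D mD _ `|2^-1 ^+ n|).
have i2sq : mu.-integrable D
    (EFin \o (fun t => 2 ^+ n * half_dist w y t ^+ 2)).
  exact: (integrableZl mD (2 ^+ n) isq).
rewrite -[leLHS]fineK; last exact: (integrable_fin_num mD ih).
rewrite lee_fin -/(Rintegral mu D (half_dist w y)).
(* From the square to the first power: [q * (h - p) ^+ 2 >= 0] with [p = 2^-n] and [q = 2^n] gives
   [h <= p + q * h ^+ 2]. *)
apply: (@le_trans _ _
    (\int[mu]_(t in D) (2^-1 ^+ n + 2 ^+ n * half_dist w y t ^+ 2))).
  apply: le_Rintegral => //; first exact: (integrableD mD icst i2sq).
  move=> t _; set h := half_dist w y t.
  have h0' : 0 <= h := h0 t.
  have p2 : 2 ^+ n * 2^-1 ^+ n = 1 :> R by rewrite -exprMn divff// expr1n.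
  have q0 : 0 < 2 ^+ n :> R by rewrite exprn_gt0.
  have : 0 <= 2 ^+ n * (h - 2^-1 ^+ n) ^+ 2 by rewrite mulr_ge0 ?sqr_ge0// ltW.
  move: p0 q0 p2; set p := 2^-1 ^+ n; set q := 2 ^+ n => p0 q0 p2.
  have -> : q * (h - p) ^+ 2 = q * h ^+ 2 - 2 * h * (q * p) + p * (q * p) by ring.
  rewrite p2 -/(half_dist w y t) -/h; lra.
rewrite RintegralD// RintegralZl// Rintegral_cst//.
have -> : (fine (mu D) + 4) * 2^-1 ^+ n =
    2^-1 ^+ n * fine (mu D) + 2 ^+ n * (4 * 4^-1 ^+ n) :> R.
  have -> : 4^-1 ^+ n = 2^-1 ^+ n * 2^-1 ^+ n :> R.
    by rewrite -exprMn; congr (_ ^+ _); field.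
  have p2 : 2 ^+ n * 2^-1 ^+ n = 1 :> R by rewrite -exprMn divff// expr1n.
  have -> : 2 ^+ n * (4 * (2^-1 ^+ n * 2^-1 ^+ n)) =
    4 * (2 ^+ n * 2^-1 ^+ n) * 2^-1 ^+ n :> R by ring.
  by rewrite p2; ring.
rewrite lerD2l; apply: ler_wpM2l => //; exact: exprn_ge0.
Qed.

(** Once the infimum of [J] over [A (S n)] is within [4^-n] of the supremum of all infima,
    near-minimisers over any smaller [A (x :: S n)] are close to those over [A (S n)]. Hence a
    single [f] serves every [x], even for uncountable [X]; only the exceptional null set depends on
    [x]. Working with [expR (- w / 2)] keeps values in [[0, 1]], so [f] makes sense even where the
    functions tend to infinity. *)
Lemma forward_limit (X : Type) (x0 : X) (A : seq X -> set (T -> R)) :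
  (forall s, A s !=set0) ->
  (forall s w, A s w -> measurable_fun D w /\ forall t, 0 <= w t) ->
  (forall s w y, A s w -> A s y ->
     A s (fun t => 2^-1 * w t + (1 - 2^-1) * y t)) ->
  (forall s1 s2, A (s1 ++ s2) `<=` A s1) ->
  (forall s1 s2, A (s1 ++ s2) `<=` A s2) ->
  exists (f : T -> R) (S : nat -> seq X), [/\ measurable_fun D f,
    forall n, (n <= size (S n))%N &
    forall x, exists2 y : nat -> T -> R, forall n, A (x :: S n) (y n) &
      {ae mu, forall t, D t ->
         expR (- (2^-1 * y n t)) @[n --> \oo] --> f t}].
Proof.
move=> Aneq0 Anneg Amid Al Ar.
have J0 w : 0 <= J w by apply: Rintegral_ge0 => t _; exact: expR_ge0.
have JC s w : A s w -> J w <= fine (mu D).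
  move=> /Anneg nw; rewrite -[leRHS]mul1r -Rintegral_cst//.
  apply: le_Rintegral => //; first exact: iexp.
    by apply: (@integrable_bounded _ _ _ mu D mD _ `|1|).
  by move=> t _; rewrite -expR0 ler_expR oppr_le0; case: nw.
pose j s := inf [set J w | w in A s].
have jinf s : has_inf [set J w | w in A s].
  split; first by have [w Aw] := Aneq0 s; exists (J w), w.
  by exists 0 => _ [w _ <-].
have jle s w : A s w -> j s <= J w.
  by move=> Aw; apply: ge_inf; [case: (jinf s) | exists w].
have jsup : has_sup (range j).
  split; first by exists (j [::]), [::].
  exists (fine (mu D)) => _ [s _ <-].
  by have [w Aw] := Aneq0 s; apply: le_trans (jle _ _ Aw) (JC _ _ Aw).
pose j' := sup (range j).
have jj' s : j s <= j' by apply: sup_ubound; [case: jsup | exists s].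
have q0 n : 0 < 4^-1 ^+ n :> R by rewrite exprn_gt0.
have /choice[s_ s_P] n : exists s, j' - 4^-1 ^+ n < j s.
  by have [_ [s _ <-] ?] := sup_adherent (q0 n) jsup; exists s.
(* The prefix [s_ n] brings the infimum near its supremum, the tail [S n'] makes the sets decrease,
   and the padding by [x0] forces the length to be at least [n]. *)
pose S := fix S n := if n is n'.+1 then s_ n ++ x0 :: S n' else s_ 0%N.
have AS n w : A (S n) w -> j' - 4^-1 ^+ n < J w.
  move=> Aw; apply: (lt_le_trans (s_P n)); apply: jle.
  by case: n Aw => [//|n]; exact: Al.
have SS n : A (S n.+1) `<=` A (S n).
  by move=> w /Ar Aw; apply: (Ar [:: x0]).
have near n s : exists2 w, A s w & J w < j' + 4^-1 ^+ n.
  have [_ [w Aw <-] Jw] := inf_adherent (q0 n) (jinf s).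
  by exists w => //; apply: (lt_le_trans Jw); rewrite lerD2r; exact: jj'.
have closeS n w y : A (S n) w -> A (S n) y ->
    J w < j' + 4^-1 ^+ n -> J y < j' + 4^-1 ^+ n ->
  (\int[mu]_(t in D) (half_dist w y t)%:E <=
   ((fine (mu D) + 4) * 2^-1 ^+ n)%:E)%E.
  move=> Aw Ay Jw Jy; apply: (@half_dist_le w y j' n).
  - exact: Anneg Aw.
  - exact: Anneg Ay.
  - exact: ltW.
  - exact: ltW.
  - by apply/ltW/AS; exact: Amid.
have mdist n w y : A (S n) w -> A (S n) y -> measurable_fun D (half_dist w y).
  move=> /Anneg nw /Anneg ny.
  by apply: measurableT_comp => //; apply: measurable_funB; exact: mexp.
have /choice[w wP] n : exists w, A (S n) w /\ J w < j' + 4^-1 ^+ n.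
  by have [w] := near n (S n); exists w.
pose F n t := expR (- (2^-1 * w n t)).
have F0 n t : 0 <= F n t by exact: expR_ge0.
have F1 n t : F n t <= 1.
  rewrite -expR0 ler_expR oppr_le0 mulr_ge0//.
  by have [_] := Anneg _ _ (wP n).1; apply.
(* The upper limit is measurable without any convergence, and equals the limit wherever the sequence
   converges. *)
exists (fun t => limn_sup (F ^~ t)), S; split.
- apply: measurable_fun_limn_sup.
  + by move=> t _; exists 1 => _ [n _ <-].
  + by move=> t _; exists 0 => _ [n _ <-].
  + by move=> n; apply: mexp; exact: Anneg (wP n).1.
- by elim=> [//|n ih] /=; rewrite size_cat/= addnS ltnS (leq_trans ih)// leq_addl.
move=> x.
have /choice[y yP] n : exists y, A (x :: S n) y /\ J y < j' + 4^-1 ^+ n.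
  by have [y] := near n (x :: S n); exists y.
exists y => [n|]; first by have [] := yP n.
have Ay n : A (S n) (y n) by apply: (Ar [:: x]); case: (yP n).
(* Consecutive terms [w n] and [w n.+1] are thus both near-minimisers at level [n], so their
   distances are summable almost everywhere. *)
have JwS n : J (w n.+1) < j' + 4^-1 ^+ n.
  apply: (lt_le_trans (wP n.+1).2); rewrite lerD2l exprS.
  by rewrite ler_piMl ?invf_le1 ?ler1n// ltW.
have aew : {ae mu, forall t, D t ->
    cvgn (series (fun n => half_dist (w n) (w n.+1) t))}.
  apply: (@ae_cvg_series _ _ _ mu D mD _ (fine (mu D) + 4)).
  - by move=> n; apply: (mdist n); [case: (wP n)|apply: SS; case: (wP n.+1)].
  - by move=> n t _; exact: normr_ge0.
  - move=> n; apply: closeS => //; [by case: (wP n)| |by case: (wP n)].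
    by apply: SS; case: (wP n.+1).
have aey : {ae mu, forall t, D t ->
    cvgn (series (fun n => half_dist (w n) (y n) t))}.
  apply: (@ae_cvg_series _ _ _ mu D mD _ (fine (mu D) + 4)).
  - by move=> n; apply: (mdist n) => //; case: (wP n).
  - by move=> n t _; exact: normr_ge0.
  - by move=> n; apply: closeS => //; [case: (wP n)|case: (wP n)|case: (yP n)].
apply: filterS2 aew aey => t /= cw cy Dt.
have {}cw := cw Dt; have {}cy := cy Dt.
have cF : cvgn (F ^~ t).
  have -> : F ^~ t = fun n => F 0%N t + series (telescope (F ^~ t)) n.
    by apply/funext => n; exact: (eq_sum_telescope (F ^~ t)).
  apply: is_cvgD; first exact: is_cvg_cst.
  apply: normed_cvg; rewrite [X in cvgn X](_ : _ =
    series (fun n => half_dist (w n) (w n.+1) t))//.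
  by apply/funext => n; rewrite /series/=; apply: eq_bigr => i _; exact: distrC.
have -> : limn_sup (F ^~ t) = limn (F ^~ t).
  by apply/cvg_lim => //; exact: cvg_sups.
(* The distances between [w n] and [y n] are the terms of a convergent series, so they vanish in the
   limit and both sequences share it. *)
have -> : (fun n => expR (- (2^-1 * y n t))) =
   (fun n => F n t - (F n t - expR (- (2^-1 * y n t)))).
  by apply/funext => n; ring.
rewrite -[X in _ --> X]subr0; apply: cvgB => //.
apply/norm_cvg0P; exact: cvg_series_cvg_0 cy.
Qed.

End forward_limit.

(** * Lower limits and Fatou's lemma *)

Section limn_einf_bounds.
Context (R : realType).
Local Open Scope ereal_scope.
Implicit Types (u : (\bar R)^nat) (c : \bar R).

Lemma limn_einf_le u c : (forall n, u n <= c) -> limn_einf u <= c.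
Proof.
move=> uc; rewrite limn_einf_lim; apply: lime_le; first exact: is_cvg_einfs.
apply: nearW => n; apply: le_trans (uc n).
by apply: ereal_inf_lbound; exists n => /=.
Qed.

Lemma limn_einf_ge u c : (\forall n \near \oo, c <= u n) -> c <= limn_einf u.
Proof.
move=> [N _ cu]; rewrite limn_einf_lim.
apply: lime_ge; first exact: is_cvg_einfs.
exists N => // n /= Nn; apply: le_ereal_inf_tmp => _ [m /= nm <-].
by apply: cu => /=; exact: leq_trans nm.
Qed.

Lemma measurable_fun_limn_einf d (T : measurableType d) (D : set T)
    (f : (T -> \bar R)^nat) : (forall n, measurable_fun D (f n)) ->
  measurable_fun D (fun x => limn_einf (f ^~ x)).
Proof.
move=> mf; have -> : (fun x => limn_einf (f ^~ x)) =
    (fun x => - limn_esup (fun n => - f n x)).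
  apply/funext => x; rewrite -limn_einfN; congr limn_einf.
  by apply/funext => n /=; rewrite oppeK.
apply: measurableT_comp => //; apply: measurable_fun_limn_esup => n.
exact: measurableT_comp.
Qed.

(** This form of Fatou's lemma is used for two choices of [g]: one that is infinite where the limit
    would blow up, and the gauge of half the limit. *)
Lemma ae_fatou_le d (T : measurableType d) (mu : {measure set T -> \bar R})
    (D : set T) (u : (T -> \bar R)^nat) (g : T -> \bar R) c : measurable D ->
  (forall n, measurable_fun D (u n)) -> (forall n t, D t -> 0 <= u n t) ->
  measurable_fun D g -> (forall t, D t -> 0 <= g t) ->
  (forall n, \int[mu]_(t in D) u n t <= c) ->
  {ae mu, forall t, D t -> g t <= limn_einf (u ^~ t)} ->
  \int[mu]_(t in D) g t <= c.
Proof.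
move=> mD mu_ u0 mg g0 uc gu.
apply: (le_trans (ae_ge0_le_integral mD g0 mg _ _ gu)).
- by move=> t Dt; apply: limn_einf_ge; apply: nearW => n; exact: u0.
- exact: measurable_fun_limn_einf.
by apply: (le_trans (fatou mu mD mu_ u0)); exact: limn_einf_le.
Qed.

End limn_einf_bounds.

(** * Compactness of the modular ball for families of kernel inequalities *)

Section orlicz_ball_compactness.
Context d (T : measurableType d) (R : realType).
Variables (mu : {measure set T -> \bar R}) (D : set T).
Hypotheses (mD : measurable D) (muD : (mu D < +oo)%E).
Variable psi : R -> R.
Hypothesis psi0 : psi 0 = 0.
Hypothesis psi_ge0 : forall t : R, 0 <= t -> 0 <= psi t.
Hypothesis psi_convex : forall x y l : R, 0 <= x -> 0 <= y -> 0 <= l <= 1 ->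
  psi (l * x + (1 - l) * y) <= l * psi x + (1 - l) * psi y.
Hypothesis psi_superlinear : forall e : R, 0 < e -> exists L : R, forall t : R,
  0 <= t -> L <= t -> t <= e * psi t.

(** This inverts [w |-> expR (- w / 2)]; the maximum with 0 makes it nonnegative everywhere,
    including on the exceptional null set. *)
Let limw (f : T -> R) (t : T) : R := Num.max 0 (- (2 * ln (f t))).

(** Where [f] is positive, take logarithms. Elsewhere [y n] tends to infinity; Fatou's lemma for
    [g], which is infinite there, and the uniform bound on integrals over the ball show that this
    happens only on a null set. *)
Let limw_cvg (f : T -> R) (y : nat -> T -> R) :
  measurable_fun D f -> (forall n, orlicz_ball mu D psi (y n)) ->
  {ae mu, forall t, D t -> expR (- (2^-1 * y n t)) @[n --> \oo] --> f t} ->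
  {ae mu, forall t, D t -> y n t @[n --> \oo] --> limw f t}.
Proof.
move=> mf Ky yf.
have my n : measurable_fun D (y n) by case: (Ky n).
have y0 n t : 0 <= y n t by case: (Ky n).
have [B [_ hB]] := orlicz_ball_integral_le mD muD psi0 psi_ge0 psi_convex
  psi_superlinear.
pose g t := if 0 < f t then 0%E else (+oo : \bar R)%E.
have mg : measurable_fun D g.
  have -> : g = (fun x : R => if 0 < x then 0%E else (+oo : \bar R)%E) \o f by [].
  apply: measurableT_comp => //; apply: measurable_fun_ifT => //.
  exact: measurable_fun_ltr.
have g0 t : D t -> (0 <= g t)%E by rewrite /g; case: ifP.
have gB : (\int[mu]_(t in D) g t <= B%:E)%E.
  apply: (@ae_fatou_le _ _ _ mu D (fun n t => (y n t)%:E)) => //.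
  - by move=> n; exact/measurable_EFinP.
  - by move=> n t _; rewrite lee_fin.
  - move=> n; rewrite -[leLHS]fineK ?lee_fin; first exact: hB.
    apply: integrable_fin_num => //.
    exact: (orlicz_ball_integrable mD muD psi0 psi_ge0 psi_convex psi_superlinear).
  apply: filterS yf => t /= yf Dt; have {}yf := yf Dt.
  rewrite /g; case: ltP => [_|f0].
    by apply: limn_einf_ge; apply: nearW => n; rewrite lee_fin.
  have yoo : (y n t)%:E @[n --> \oo] --> +oo%E.
    apply/cvgeryP/cvgryPge => A.
    have : f t < expR (- (2^-1 * A)) by rewrite (le_lt_trans f0) ?expR_gt0.
    move=> /(cvgr_lt (f t) yf); apply: filterS => n.
    by rewrite ltr_expR ltrN2 => ?; lra.
  by rewrite (cvg_limn_einf_sup yoo).1.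
have gint : mu.-integrable D g.
  apply/integrableP; split=> //.
  rewrite (eq_integral g).
    exact: le_lt_trans gB (ltry _).
  by move=> t; rewrite inE => Dt; rewrite gee0_abs// g0.
have := integrable_ae mD gint; apply: filterS2 yf => t /= yf gfin Dt.
have {}yf := yf Dt; have {}gfin := gfin Dt.
have f0 : 0 < f t by move: gfin; rewrite /g; case: ifP.
have yl : y n t @[n --> \oo] --> - (2 * ln (f t)).
  have -> : (fun n => y n t) = (fun n => - (2 * ln (expR (- (2^-1 * y n t))))).
    by apply/funext => n; rewrite expRK; field.
  apply: cvgN; apply: cvgM; [exact: cvg_cst|]; apply: continuous_cvg yf.
  exact: continuous_ln.
have l0 : 0 <= - (2 * ln (f t)).
  have <- : limn (fun n => y n t) = - (2 * ln (f t)) by apply/cvg_lim.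
  by apply: limr_ge; [apply/cvg_ex; eexists; exact: yl | apply: nearW => n].
by rewrite /limw max_r.
Qed.

Variables (X : eqType) (x0 : X) (k : X -> T -> R) (M : X -> R) (v : X -> R).
Hypotheses (mk : forall x, measurable_fun D (k x))
  (k0 : forall x t, 0 <= k x t) (kM : forall x t, k x t <= M x).

(** The limit is common to all [x], while the sequence [yP x] serves to pass to the limit in the
    inequality at [x]. The factor [2^-1] lets monotonicity of [psi] stand in for continuity: where
    the limit is positive, [y n] eventually exceeds half of it. *)
Lemma orlicz_ball_compact :
  (forall (s : seq X) (e : R), 0 < e -> exists2 w, orlicz_ball mu D psi w &
     forall x, x \in s -> v x - e <= \int[mu]_(t in D) (k x t * w t)) ->
  exists w : T -> R, [/\ measurable_fun D w, forall t, 0 <= w t,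
    (\int[mu]_(t in D) (psi (2^-1 * w t))%:E <= 1)%E &
    forall x, ((v x)%:E <= \int[mu]_(t in D) (k x t * w t)%:E)%E].
Proof.
move=> fin.
pose ball := orlicz_ball mu D psi.
(* The tolerance decreases with the length of [s], so the sets are nested under concatenation; as
   the length of [S n] is at least [n], the tolerance tends to 0. *)
pose A (s : seq X) := [set w | ball w /\ forall x, x \in s ->
   v x - (size s).+1%:R^-1 <= \int[mu]_(t in D) (k x t * w t)].
have inv_le (m n : nat) : (m <= n)%N -> n.+1%:R^-1 <= m.+1%:R^-1 :> R.
  by move=> mn; rewrite lef_pV2 ?posrE ?ltr0n// ler_nat ltnS.
have [||||| f [S [mf sizeS yP]]] := @forward_limit _ _ _ mu D mD muD X x0 A.
- move=> s; have e0 : 0 < (size s).+1%:R^-1 :> R by rewrite invr_gt0 ltr0n.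
  by have [w Kw ws] := fin s _ e0; exists w.
- by move=> s w [[]].
- have h01 : 0 <= (2^-1 : R) <= 1 by rewrite invr_ge0 ler0n invf_le1 ?ler1n.
  move=> s w y [Kw ws] [Ky ys]; split; first exact: orlicz_ball_convex.
  move=> x xs; rewrite (orlicz_ball_kernel_convex mD muD psi0 psi_ge0 psi_convex
    psi_superlinear (mk x) (k0 x) (kM x) _ Kw Ky).
  have := ws x xs; have := ys x xs; set c := v x - _; clearbody c.
  by set a := \int[_]_(_ in _) _; set b := \int[_]_(_ in _) _; lra.
- move=> s1 s2 w [Kw ws]; split=> // x xs.
  apply: le_trans (ws x _); last by rewrite mem_cat xs.
  by rewrite lerD2l lerN2 inv_le// size_cat leq_addr.
- move=> s1 s2 w [Kw ws]; split=> // x xs.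
  apply: le_trans (ws x _); last by rewrite mem_cat xs orbT.
  by rewrite lerD2l lerN2 inv_le// size_cat leq_addl.
have mw : measurable_fun D (limw f).
  apply: measurable_maxr => //; apply: measurable_funN; apply: measurable_funM => //.
  exact: measurableT_comp.
have w0 t : 0 <= limw f t by rewrite le_max lexx.
have mhw : measurable_fun D (fun t => 2^-1 * limw f t) by exact: measurable_funM.
have hw0 t : 0 <= 2^-1 * limw f t by rewrite mulr_ge0.
exists (limw f); split=> //.
  have [y Ay /limw_cvg yw] := yP x0.
  have Ky n : ball (y n) by have [] := Ay n.
  apply: (@ae_fatou_le _ _ _ mu D (fun n t => (psi (y n t))%:E)) => //.
  - move=> n; apply/measurable_EFinP; have [myn yn0 _] := Ky n.
    exact: gauge_measurable.
  - by move=> n t _; have [_ yn0 _] := Ky n; rewrite lee_fin psi_ge0.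
  - exact/measurable_EFinP/gauge_measurable.
  - by move=> t _; rewrite lee_fin psi_ge0.
  - by move=> n; have [] := Ky n.
  apply: filterS (yw mf Ky) => t /= {}yw Dt; have {}yw := yw Dt.
  apply: limn_einf_ge.
  have [wt0|wt0] := eqVneq (limw f t) 0.
    apply: nearW => n; rewrite wt0 mulr0 psi0 lee_fin psi_ge0//.
    by have [_ yn0 _] := Ky n.
  have wtp : 0 < limw f t by rewrite lt_def wt0 w0.
  have : 2^-1 * limw f t < limw f t by lra.
  move=> /(cvgr_gt _ yw); apply: filterS => n hn.
  by rewrite lee_fin (gauge_le psi0 psi_ge0 psi_convex)// ltW.
move=> x; have [y Ay /limw_cvg yw] := yP x.
have Ky n : ball (y n) by have [] := Ay n.
have {}yw := yw mf Ky.
have M0 : 0 <= M x by apply: le_trans (k0 x point) (kM x point).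
have M1 : 0 < M x + 1 by rewrite ltr_wpDl.
apply/lee_addgt0Pr => e e0.
(* The [+ 1] guards against [M x = 0]; the truncation error [M x * (e / (M x + 1))] stays below
   [e]. *)
have e'0 : 0 < e / (M x + 1) by rewrite divr_gt0.
have [L L0 hL] := orlicz_ball_kernel_truncate mD muD psi0 psi_ge0 psi_convex
  psi_superlinear (mk x) (k0 x) (kM x) e'0.
have Me : M x * (e / (M x + 1)) <= e.
  by rewrite mulrCA ler_piMr ?(ltW e0)// ler_pdivrMr// mul1r lerDl.
have mmin (w : T -> R) : measurable_fun D w ->
    measurable_fun D (fun t => k x t * Num.min (w t) L).
  by move=> mw'; apply: measurable_funM => //; exact: measurable_minr.
(* After truncation at [L] the constant [M x * L] dominates, and it is integrable since [mu D] is
   finite. *)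
have [||||| imin _ cvmin] := @dominated_convergence _ _ _ mu D mD
  (fun n t => (k x t * Num.min (y n t) L)%:E)
  (fun t => (k x t * Num.min (limw f t) L)%:E)
  (fun t => (M x * L)%:E).
- by move=> n; apply/measurable_EFinP/mmin; case: (Ky n).
- exact/measurable_EFinP/mmin.
- apply: filterS yw => t /= yw Dt; have {}yw := yw Dt.
  have cmin : Num.min (y n t) L @[n --> \oo] --> Num.min (limw f t) L.
    have cL : {for limw f t, continuous (fun z : R => Num.min z L)}.
      by apply: continuous_min; [exact: cvg_id|exact: cvg_cst].
    exact: (continuous_cvg _ cL yw).
  apply: cvg_EFin; first exact: nearW.
  exact: (cvgM (cvg_cst _) cmin).
- by apply: (@integrable_bounded _ _ _ mu D mD (fun=> M x * L) `|M x * L|).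
- apply: aeW => t n Dt; have [_ yn0 _] := Ky n.
  rewrite lee_fin ger0_norm; last by rewrite mulr_ge0// le_min yn0.
  by apply: ler_pM => //; rewrite ?le_min ?yn0// ge_min lexx orbT.
apply: (@le_trans _ _
    (\int[mu]_(t in D) (k x t * Num.min (limw f t) L)%:E + e%:E)%E); last first.
  rewrite leeD2r//; apply: ge0_le_integral => //.
  - by move=> t _; rewrite lee_fin mulr_ge0// le_min w0.
  - exact/measurable_EFinP/mmin.
  - exact/measurable_EFinP/measurable_funM.
  - by move=> t _; rewrite lee_fin ler_wpM2l// ge_min lexx.
have fini : (\int[mu]_(t in D) (k x t * Num.min (limw f t) L)%:E)%E \is a fin_num.
  exact: (integrable_fin_num mD imin).
have cvR : (\int[mu]_(t in D) (k x t * Num.min (y n t) L)) @[n --> \oo] -->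
    \int[mu]_(t in D) (k x t * Num.min (limw f t) L).
  by apply: fine_cvg; rewrite fineK.
rewrite -(fineK fini) -EFinD lee_fin -/(Rintegral mu D _).
have cvl : (v x - (size (x :: S n)).+1%:R^-1 : R) @[n --> \oo] --> v x.
  rewrite -[X in _ --> X]subr0; apply: cvgB; first exact: cvg_cst.
  apply: (@squeeze_cvgr _ _ _ _ (fun=> 0) (@harmonic R)).
  - apply: nearW => n; rewrite invr_ge0 ler0n/=.
    by apply: inv_le => /=; rewrite (leq_trans (sizeS n)).
  - exact: cvg_cst.
  - exact: cvg_harmonic.
apply: (ler_cvg_to cvl (cvgD cvR (cvg_cst e))).
apply: nearW => n /=.
have [_ yn] := Ay n.
apply: (le_trans (yn x (mem_head _ _))).
apply: (le_trans (hL _ (Ky n))).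
by rewrite lerD2l.
Qed.

End orlicz_ball_compactness.

(** * Tonelli's theorem on a measurable rectangle *)

Section tonelli_on_sets.
Context d1 d2 (T1 : measurableType d1) (T2 : measurableType d2) (R : realType).
Variables (mu : {measure set T1 -> \bar R})
  (nu : {sigma_finite_measure set T2 -> \bar R}).
Variables (A : set T1) (B : set T2) (f : T1 * T2 -> \bar R).
Hypotheses (muT : (mu setT < +oo)%E) (mA : measurable A) (mB : measurable B).
Hypothesis mf : measurable_fun (A `*` B) f.
Hypothesis f0 : forall x, (A `*` B) x -> (0 <= f x)%E.
Local Open Scope ereal_scope.

Let g := f \_ (A `*` B).

Let mg : measurable_fun setT g.
Proof. by apply/(measurable_restrictT _ _).1 => //; exact: measurableX. Qed.

Let g0 x : 0 <= g x.
Proof. by apply: erestrict_ge0. Qed.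

Let gx x : (\int[nu]_y g (x, y)) = ((fun x => \int[nu]_(y in B) f (x, y)) \_ A) x.
Proof.
rewrite patchE; case: ifPn => [|xA].
  rewrite inE => Ax; rewrite [RHS]integral_mkcond; apply: eq_integral => y _.
  rewrite /g !patchE; congr (if _ then _ else _).
  by apply/idP/idP; rewrite !inE; [case | split].
rewrite integral0_eq// => y _; rewrite /g patchE ifF//; apply: contraNF xA.
by rewrite !inE; case.
Qed.

Let gy y : (\int[mu]_x g (x, y)) = ((fun y => \int[mu]_(x in A) f (x, y)) \_ B) y.
Proof.
rewrite patchE; case: ifPn => [|yB].
  rewrite inE => By; rewrite [RHS]integral_mkcond; apply: eq_integral => x _.
  rewrite /g !patchE; congr (if _ then _ else _).
  by apply/idP/idP; rewrite !inE; [case | split].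
rewrite integral0_eq// => x _; rewrite /g patchE ifF//; apply: contraNF yB.
by rewrite !inE; case.
Qed.

Lemma measurable_section_integral :
  measurable_fun A (fun x => \int[nu]_(y in B) f (x, y)).
Proof.
apply/(measurable_restrictT _ _).2 => //.
rewrite (_ : _ \_ _ = fun x => \int[nu]_y g (x, y)); last first.
  by apply/funext => x; rewrite gx.
exact: measurable_fun_fubini_tonelli_F.
Qed.

(** Apply Tonelli's theorem to [g], the extension of [f] by zero. The finite measure [mu] is
    repackaged as the sigma-finite measure [mu'] for this purpose. *)
Lemma tonelli_on_sets :
  \int[mu]_(x in A) \int[nu]_(y in B) f (x, y) =
  \int[nu]_(y in B) \int[mu]_(x in A) f (x, y).
Proof.
have fin : fin_num_fun mu.
  move=> E mE; rewrite ge0_fin_numE//; apply: le_lt_trans muT.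
  by apply: le_measure; rewrite ?inE.
have sf : sigma_finite setT mu.
  by apply: fin_num_fun_sigma_finite => //; rewrite measure0.
pose H1 := isSFinite.Build _ _ _ _ (sfinite_measure_sigma_finite sf).
pose H2 := isSigmaFinite.Build _ _ _ _ sf.
pose mu' := HB.pack_for (SigmaFiniteMeasure.type T1 R) (Measure.sort mu) H1 H2.
have mu'E : mu = mu' :> {measure set T1 -> \bar R} by exact: eq_measure.
have : \int[mu]_x \int[nu]_y g (x, y) = \int[nu]_y \int[mu]_x g (x, y).
  by rewrite mu'E; exact: (@fubini_tonelli _ _ _ _ _ mu' nu g mg g0).
under eq_integral do rewrite gx.
under [in X in _ = X -> _]eq_integral do rewrite gy.
by rewrite -!integral_mkcond.
Qed.

End tonelli_on_sets.

(** * Comparison of [phi] with its modification, and the Delta_2-condition *)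

Section strongly_convex_modification.
Variables (R : realType) (phi psi : R -> R).
Hypotheses (phi_sc : strongly_convex phi) (psi_mod : orlicz_modification phi psi).

Lemma modification_superlinear (e : R) : 0 < e -> exists L : R, forall t : R,
  0 <= t -> L <= t -> t <= e * psi t.
Proof.
move=> e0; have [_ _ _ /cvgryPge/(_ e^-1)[A [_ hA]] _] := phi_sc.
have [[t0 psiE] _ _ _] := psi_mod.
exists (Num.max t0 (Num.max 1 (A + 1))) => t _.
rewrite !ge_max => /and3P[t0t t1 At]; rewrite psiE//.
have tp : 0 < t by lra.
have := hA t; rewrite /= ler_pdivlMr// ler_pdivrMl// mulrC; apply; lra.
Qed.

(** Beyond [t1] the two functions agree; before it both are at most their common value [phi t1], by
    monotonicity. This passes between [phi], which defines the space, and [psi], which defines the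
    norm. *)
Lemma le_modification : exists2 c, 0 <= c & forall t, 0 <= t ->
  phi t <= psi t + c /\ psi t <= phi t + c.
Proof.
have [phi0 _ phi_nd _ _] := phi_sc.
have [[t0 psiE] psi0 psi_ge0 psi_convex] := psi_mod.
pose t1 := Num.max 0 t0.
have t10 : 0 <= t1 by rewrite le_max lexx.
have t1t : t0 <= t1 by rewrite le_max lexx orbT.
exists (phi t1) => // t t_ge0; have [tt1|tt1] := leP t1 t.
  by rewrite psiE ?lerDl// (le_trans t1t).
split; first by rewrite (le_trans (phi_nd _ _ (ltW tt1)))// lerDr psi_ge0.
rewrite -(psiE t1)//.
have := gauge_le psi0 psi_ge0 psi_convex t_ge0 (ltW tt1).
by move=> /le_trans; apply; rewrite lerDr.
Qed.

(** Iterating the Delta_2-condition with equal arguments gives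
    [phi (2 ^+ n * t) <= (2 * c) ^+ n * phi t] for large [t]; take [2 ^+ n >= C]. The constant [b]
    takes care of small [t]. *)
Lemma Delta2_scale (C : R) : Delta2 phi -> 0 <= C ->
  exists a b : R, [/\ 0 <= a, 0 <= b &
    forall t, 0 <= t -> phi (C * t) <= a * phi t + b].
Proof.
move=> [c [t0 [c1 phiD]]] C0.
have [phi0 _ phi_nd _ _] := phi_sc.
pose t1 := Num.max 0 t0.
have t10 : 0 <= t1 by rewrite le_max lexx.
have dbl n t : t1 <= t -> phi (2 ^+ n * t) <= (2 * c) ^+ n * phi t.
  move=> t1t; elim: n => [|n ih]; first by rewrite !expr0 !mul1r.
  have -> : 2 ^+ n.+1 * t = 2 ^+ n * t + 2 ^+ n * t :> R by rewrite exprS; ring.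
  have t0t : t0 <= 2 ^+ n * t.
    have : t0 <= t by apply: le_trans t1t; rewrite le_max lexx orbT.
    move/le_trans; apply; rewrite ler_peMl ?exprn_ege1 ?ler1n//.
    exact: le_trans t1t.
  apply: (le_trans (phiD _ _ t0t t0t)).
  have := ler_wpM2l (_ : 0 <= 2 * c) ih.
  rewrite exprS; move=> /(_ _); rewrite -mulrA; lra.
have [n Cn] : exists n, C <= 2 ^+ n.
  exists (Num.truncn C).+1.
  have : C < (Num.truncn C).+1%:R by exact: truncnS_gt.
  move=> /ltW/le_trans; apply; rewrite -natrX ler_nat.
  exact/ltnW/ltn_expl.
exists ((2 * c) ^+ n), (phi (C * t1)); split=> // [|t t_ge0].
  by rewrite exprn_ge0//; lra.
have [t1t|t1t] := leP t1 t.
  rewrite (le_trans _ (_ : (2 * c) ^+ n * phi t <= _)) ?lerDl//.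
  by apply: le_trans (dbl n t t1t); apply: phi_nd; rewrite ler_wpM2r.
apply: (le_trans (phi_nd _ (C * t1) _)); first by rewrite ler_wpM2l// ltW.
by rewrite lerDr mulr_ge0// exprn_ge0//; lra.
Qed.

End strongly_convex_modification.

(** * Bounds and measurability of the Poisson kernel *)

Section poisson_kernel_bounds.
Variable R : realType.
Implicit Types (z : R * R) (t : R).

(** With [r = |z|], the Cauchy-Schwarz inequality gives [|zeta - z| >= 1 - r], and
    [1 - r >= (1 - r ^+ 2) / 2] because [r < 1]. The bound is uniform in the angle. *)
Lemma poisson_denom_ge z t : unit_disk R z ->
  ((1 - (z.1 ^+ 2 + z.2 ^+ 2)) / 2) ^+ 2 <=
  (cos t - z.1) ^+ 2 + (sin t - z.2) ^+ 2.
Proof.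
rewrite /unit_disk/=; case: z => x y /= q1.
have cs := cos2Dsin2 t; set c := cos t in cs *; set s := sin t in cs *.
set q := x ^+ 2 + y ^+ 2 in q1 *.
pose r := Num.sqrt q.
have q0 : 0 <= q by rewrite addr_ge0 ?sqr_ge0.
have r0 : 0 <= r by exact: sqrtr_ge0.
have rq : r ^+ 2 = q by rewrite sqr_sqrtr.
have p2 : (x * c + y * s) ^+ 2 <= r ^+ 2.
  rewrite rq -[leRHS]mulr1 -cs /q -subr_ge0.
  have -> : (x ^+ 2 + y ^+ 2) * (c ^+ 2 + s ^+ 2) - (x * c + y * s) ^+ 2 =
    (x * s - y * c) ^+ 2 by ring.
  exact: sqr_ge0.
have p : x * c + y * s <= r.
  have [h|/ltW h] := leP 0 (x * c + y * s); last exact: le_trans h r0.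
  by move: p2; rewrite ler_sqr ?nnegrE.
have -> : (c - x) ^+ 2 + (s - y) ^+ 2 = 1 - 2 * (x * c + y * s) + q.
  have <- : c ^+ 2 + s ^+ 2 - 2 * (x * c + y * s) + q = 1 - 2 * (x * c + y * s) + q.
    by rewrite cs.
  by rewrite /q; ring.
apply: (@le_trans _ _ ((1 - r) ^+ 2)); last by rewrite -rq; nra.
have r1 : r < 1 by rewrite -(@ltr_sqr _ r 1) ?nnegrE// rq expr1n.
rewrite ler_sqr ?nnegrE; [rewrite -rq; nra | rewrite -rq; nra | lra].
Qed.

Lemma poisson_denom_gt0 z t : unit_disk R z ->
  0 < (cos t - z.1) ^+ 2 + (sin t - z.2) ^+ 2.
Proof.
move=> Dz; apply: lt_le_trans (poisson_denom_ge t Dz).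
by rewrite exprn_gt0// divr_gt0// subr_gt0.
Qed.

Lemma poisson_kernel_ge0 z t : unit_disk R z -> 0 <= poisson_kernel z t.
Proof.
move=> Dz; rewrite divr_ge0// ?subr_ge0; first exact: ltW.
exact/ltW/poisson_denom_gt0.
Qed.

Lemma poisson_kernel_le z t : unit_disk R z ->
  poisson_kernel z t <= 4 / (1 - (z.1 ^+ 2 + z.2 ^+ 2)).
Proof.
move=> Dz; have := poisson_denom_ge t Dz.
rewrite /poisson_kernel ler_pdivrMr ?poisson_denom_gt0//.
have : 0 < 1 - (z.1 ^+ 2 + z.2 ^+ 2) by rewrite subr_gt0.
set q := 1 - _; set e := _ + _ => q0 qe.
rewrite mulrAC ler_pdivlMr//.
by move: qe; rewrite expr_div_n ler_pdivrMr ?exprn_gt0//; lra.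
Qed.

Lemma measurable_unit_disk : measurable (unit_disk R).
Proof.
have -> : unit_disk R = setT `&` (fun z => z.1 ^+ 2 + z.2 ^+ 2) @^-1` `]-oo, 1[.
  by apply/seteqP; split => z; rewrite setTI /unit_disk/= in_itv/=.
have : measurable_fun setT (fun z : R * R => z.1 ^+ 2 + z.2 ^+ 2).
  by apply: measurable_funD; apply: measurable_funX;
    [exact: measurable_fst | exact: measurable_snd].
by apply=> //; exact: measurable_itv.
Qed.

Lemma measurable_poisson_kernel (B : set R) : measurable B ->
  measurable_fun (unit_disk R `*` B)
    (fun zt : (R * R) * R => poisson_kernel zt.1 zt.2).
Proof.
move=> mB; pose N (zt : (R * R) * R) := 1 - (zt.1.1 ^+ 2 + zt.1.2 ^+ 2).
pose Q (zt : (R * R) * R) :=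
  (cos zt.2 - zt.1.1) ^+ 2 + (sin zt.2 - zt.1.2) ^+ 2.
have m11 : measurable_fun setT (fun zt : (R * R) * R => zt.1.1).
  exact: (measurableT_comp measurable_fst measurable_fst).
have m12 : measurable_fun setT (fun zt : (R * R) * R => zt.1.2).
  exact: (measurableT_comp measurable_snd measurable_fst).
have mcos : measurable_fun setT (fun zt : (R * R) * R => cos zt.2).
  apply: (measurableT_comp _ measurable_snd).
  by apply: continuous_measurable_fun; exact: continuous_cos.
have msin : measurable_fun setT (fun zt : (R * R) * R => sin zt.2).
  apply: (measurableT_comp _ measurable_snd).
  by apply: continuous_measurable_fun; exact: continuous_sin.
have mN : measurable_fun setT N.
  by apply: measurable_funB => //; apply: measurable_funD; exact: measurable_funX.
have mQ : measurable_fun setT Q.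
  by apply: measurable_funD; apply: measurable_funX; exact: measurable_funB.
(* On the disk the denominator is positive, so its inverse is [exp (- ln)]. *)
apply: (@eq_measurable_fun _ _ _ _ _ (fun zt => N zt * expR (- ln (Q zt)))).
  move=> [z t]; rewrite inE => -[/= Dz _].
  by rewrite /poisson_kernel /N/= expRN lnK// posrE poisson_denom_gt0.
apply: measurable_funTS; apply: measurable_funM => //.
apply: measurableT_comp => //; apply: measurable_funN.
exact: measurableT_comp.
Qed.

Lemma measurable_poisson_kernel_point t :
  measurable_fun (unit_disk R) (fun z => poisson_kernel z t).
Proof.
have mzt : measurable_fun (unit_disk R) (fun z => (z, t)).
  exact/measurable_funTS/measurable_pair2.
move=> mD Y mY.
have mDT := measurableX mD (@measurableT _ R).
have := measurable_poisson_kernel (@measurableT _ R) mDT mY.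
move=> /(mzt mD); congr measurable.
by apply/seteqP; split => z /=; [case=> ? [[]] | case].
Qed.

Lemma measurable_poisson_kernel_angle z (B : set R) : measurable B ->
  unit_disk R z -> measurable_fun B (poisson_kernel z).
Proof.
move=> mB Dz.
have mBD : measurable_fun B (fun t => (z, t)).
  exact/measurable_funTS/measurable_pair1.
move=> _ Y mY.
have := measurable_poisson_kernel mB (measurableX measurable_unit_disk mB) mY.
move=> /(mBD mB); congr measurable.
by apply/seteqP; split => t /=; [case=> ? [[]] | case].
Qed.

End poisson_kernel_bounds.

(** * Normalized Lebesgue measure on the circle *)

Section circle_measure.
Variable R : realType.

Let c := (2 * pi : R)^-1.

Let c0 : 0 <= c.
Proof. by rewrite invr_ge0 mulr_ge0 ?pi_ge0. Qed.

(** Moving the factor [(2 * pi)^-1] into the measure makes the results on a general finite measure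
    applicable to [Tint]. *)
Definition circle_measure : {measure set (measurableTypeR R) -> \bar R} :=
  [the measure _ _ of mscale (NngNum c0) (@lebesgue_measure R)].

Definition circle : set R := `[0%R, (2 * pi)%R[%classic.

Lemma measurable_circle : measurable circle.
Proof. exact: measurable_itv. Qed.

Lemma circle_measure_lty : (circle_measure circle < +oo)%E.
Proof.
change (c%:E * (@lebesgue_measure R) circle < +oo)%E.
rewrite /circle lebesgue_measure_itv/=.
by case: ifP => _; rewrite ?mule0 ?ltry// -EFinB -EFinM ltry.
Qed.

Lemma TintE (f : R -> \bar R) : measurable_fun circle f ->
  (forall t, circle t -> (0 <= f t)%E) ->
  Tint f = (\int[circle_measure]_(t in circle) f t)%E.
Proof.
move=> mf f0.
exact/esym/(ge0_integral_mscale (@lebesgue_measure R) measurable_circle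
  (NngNum c0) mf f0).
Qed.

End circle_measure.
Arguments circle R : clear implicits.
Arguments circle_measure R : clear implicits.

(** * Finitely supported measures *)

(** These sums of weighted Dirac masses are the test measures for the balayage bound. They are built
    by induction on the list, so repeated points are allowed. *)
Lemma exists_discrete_measure d (T : measurableType d) (R : realType)
    (D : set T) (X : Type) (p : X -> T) (a : X -> R) (s : seq X) :
  measurable D -> (forall x, D (p x)) -> (forall x, 0 <= a x) ->
  exists mu : {measure set T -> \bar R}, [/\ mu (~` D) = 0%E,
    (mu setT < +oo)%E &
    forall f, (forall x, D x -> (0 <= f x)%E) -> measurable_fun D f ->
      (\int[mu]_(z in D) f z = \sum_(x <- s) (a x)%:E * f (p x))%E].
Proof.
move=> mD Dp a0; elim: s => [|x s [mu [muD muT muI]]].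
  exists [the measure _ _ of mzero]; split=> //; first exact: ltry.
  by move=> f f0 mf; rewrite big_nil; exact: integral_measure_zero.
pose nu := [the measure _ _ of mscale (NngNum (a0 x)) (\d_(p x))].
exists [the measure _ _ of measure_add nu mu]; split.
- rewrite [LHS]measure_addE muD adde0.
  change ((a x)%:E * \d_(p x) (~` D) = 0 :> \bar R)%E.
  by rewrite diracE memNset ?mule0//=; exact.
- rewrite [X in (X < _)%E]measure_addE lte_add_pinfty//.
  change ((a x)%:E * \d_(p x) setT < (+oo : \bar R))%E.
  by rewrite diracE mem_set// mule1 ltry.
move=> f f0 mf.
rewrite big_cons -muI// -[LHS]/(integral (measure_add nu mu) D f).
rewrite ge0_integral_measure_add//; congr (_ + _)%E.
transitivity ((a x)%:E * \int[\d_(p x)]_(z in D) f z)%E.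
  exact: (ge0_integral_mscale _ mD (NngNum (a0 x)) mf f0).
by rewrite integral_dirac// diracE mem_set// mul1e.
Qed.

(** * From a Poisson majorant to the balayage bound *)

Section majorant.
Variables (R : realType) (phi psi : R -> R) (u : R * R -> R).
Hypotheses (phi_sc : strongly_convex phi) (psi_mod : orlicz_modification phi psi).
Hypothesis mu_ : measurable_fun (unit_disk R) u.
Hypothesis u0 : forall z, unit_disk R z -> 0 <= u z.

Let mI : measurable (circle R). Proof. exact: measurable_circle. Qed.

Let mpsi_abs (w : R -> R) : measurable_fun (circle R) w ->
  measurable_fun (circle R) (fun t => (psi `|w t|)%:E).
Proof.
have [_ psi0 psi_ge0 psi_convex] := psi_mod.
move=> mw; apply/measurable_EFinP.
apply: (gauge_measurable psi0 psi_ge0 psi_convex) => //.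
exact: measurableT_comp.
Qed.

Let mphi_abs (w : R -> R) : measurable_fun (circle R) w ->
  measurable_fun (circle R) (fun t => (phi `|w t|)%:E).
Proof.
have [_ _ phi_nd _ _] := phi_sc.
move=> mw; apply/measurable_EFinP.
apply: (measurableT_comp (nondecreasing_measurable measurableT phi_nd)).
exact: measurableT_comp.
Qed.

Let Tint_psi (w : R -> R) : measurable_fun (circle R) w ->
  Tint (fun t => (psi `|w t|)%:E) =
  (\int[circle_measure R]_(t in circle R) (psi `|w t|)%:E)%E.
Proof.
move=> mw; apply: TintE; first exact: mpsi_abs.
by have [_ _ psi_ge0 _] := psi_mod => t _; rewrite lee_fin psi_ge0.
Qed.

Let Tint_phi (w : R -> R) : measurable_fun (circle R) w ->
  Tint (fun t => (phi `|w t|)%:E) =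
  (\int[circle_measure R]_(t in circle R) (phi `|w t|)%:E)%E.
Proof.
move=> mw; apply: TintE; first exact: mphi_abs.
by have [phi0 _ _ _ _] := phi_sc => t _; rewrite lee_fin.
Qed.

(** Take for [r] the maximum of 1 and the modular of [w]. As [1 / r <= 1], convexity gives
    [psi (|w| / r) <= psi |w| / r], so the modular of [w / r] is at most 1 and [t = 1] is admissible
    in the norm. *)
Lemma in_orlicz_unit_norm (w : R -> R) : in_orlicz phi w ->
  exists2 r : R, 1 <= r & in_orlicz phi (fun t => w t / r) /\
    (orlicz_norm psi (fun t => w t / r)%R <= 1)%E.
Proof.
move=> [mw wphi].
have [phi0 _ phi_nd _ _] := phi_sc.
have [_ psi0 psi_ge0 psi_convex] := psi_mod.
have [c c0 hc] := le_modification phi_sc psi_mod.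
have wpsi : (Tint (fun t => (psi `|w t|)%:E) < +oo)%E.
  rewrite Tint_psi//; rewrite Tint_phi// in wphi.
  apply: (@le_lt_trans _ _ (\int[circle_measure R]_(t in circle R)
     ((phi `|w t|)%:E + c%:E))%E).
    apply: ge0_le_integral => //.
    - by move=> t _; rewrite lee_fin psi_ge0.
    - exact: mpsi_abs.
    - by apply: emeasurable_funD => //; exact: mphi_abs.
    - by move=> t _; rewrite lee_fin; have [] := hc `|w t| (normr_ge0 _).
  rewrite ge0_integralD//.
  - rewrite lte_add_pinfty//.
    by rewrite integral_cst// lte_mul_pinfty// circle_measure_lty.
  - by move=> t _; rewrite lee_fin.
  - exact: mphi_abs.
have wpsi0 : (0 <= Tint (fun t => (psi `|w t|)%:E))%E.
  rewrite Tint_psi//; apply: integral_ge0 => t _.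
  by rewrite lee_fin psi_ge0.
have := fineK (_ : Tint (fun t => (psi `|w t|)%:E) \is a fin_num).
rewrite ge0_fin_numE// => /(_ wpsi); set r0 := fine _ => r0E.
pose r := Num.max 1 r0.
have r1 : 1 <= r by rewrite le_max lexx.
have rp : 0 < r by rewrite (lt_le_trans ltr01).
have mwr : measurable_fun (circle R) (fun t => w t / r).
  exact: measurable_funM.
exists r => //; split.
  split=> //; apply: le_lt_trans wphi.
  rewrite !Tint_phi//.
  apply: ge0_le_integral => //.
  - by move=> t _; rewrite lee_fin.
  - exact: (mphi_abs mwr).
  - exact: mphi_abs.
  move=> t _; rewrite lee_fin; apply: phi_nd.
  rewrite normrM normfV (gtr0_norm rp) ler_piMr// invf_le1//.
apply: ereal_inf_lbound; exists 1 => //=; split => //.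
under [X in Tint X]eq_fun do rewrite divr1.
apply: (@le_trans _ _ (r^-1%:E * Tint (fun t => (psi `|w t|)%:E))%E).
  rewrite !Tint_psi//.
  rewrite -ge0_integralZl//; last 3 first.
  - exact: mpsi_abs.
  - by move=> t _; rewrite lee_fin psi_ge0.
  - by rewrite lee_fin invr_ge0 ltW.
  apply: ge0_le_integral => //.
  - by move=> t _; rewrite lee_fin psi_ge0.
  - exact: (mpsi_abs mwr).
  - by apply: measurable_funeM; exact: mpsi_abs.
  move=> t _; rewrite -EFinM lee_fin normrM normfV (gtr0_norm rp) mulrC.
  apply: (gauge_scale psi0 psi_convex) => //.
  by rewrite invr_ge0 (ltW rp) invf_le1.
rewrite -r0E -EFinM lee_fin ler_pdivrMl// mulr1.
by rewrite le_max lexx orbT.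
Qed.

(** By Tonelli's theorem the integral of [P[|w| / r]] against [mu] is that of [|w| / r] against the
    balayage, hence at most 1. Since [u <= r * P[|w| / r]], the constant is [r]. *)
Lemma balayage_bound_of_majorant (w : R -> R) : in_orlicz phi w ->
  (forall z, unit_disk R z -> ((u z)%:E <= poisson_int w z)%E) ->
  exists C : R, 0 <= C /\
    forall mu : {measure set (R * R) -> \bar R}, B_phistar phi psi mu ->
      (\int[mu]_(z in unit_disk R) (u z)%:E <= C%:E)%E.
Proof.
move=> wL uw; have [mw _] := wL.
have [r r1 [wrL wr1]] := in_orlicz_unit_norm wL.
have rp : 0 < r by rewrite (lt_le_trans ltr01).
have r0 := ltW rp.
exists r; split=> // mu [muD muT mu1].
have {mu1} := mu1 _ wrL wr1.
have mDisk := @measurable_unit_disk R.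
pose c := (2 * pi : R)^-1.
have c0 : 0 <= c by rewrite invr_ge0 mulr_ge0 ?pi_ge0.
pose f (zt : (R * R) * R) := (poisson_kernel zt.1 zt.2 * `|w zt.2 / r|)%:E.
have mwr : measurable_fun (circle R) (fun t => `|w t / r|).
  by apply: measurableT_comp => //; exact: measurable_funM.
have mf : measurable_fun (unit_disk R `*` circle R) f.
  apply/measurable_EFinP; apply: measurable_funM.
    exact: measurable_poisson_kernel.
  move=> mDI Y mY.
  have msnd : measurable_fun setT (@snd (R * R) R) by exact: measurable_snd.
  have := msnd measurableT _ (mwr mI Y mY).
  rewrite setTI => h.
  have := measurableI _ _ mDI h; congr measurable.
  by apply/seteqP; split => -[z t] /=; [case=> ? [] | case=> -[]].
have f0 x : (unit_disk R `*` circle R) x -> (0 <= f x)%E.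
  by case: x => z t [/= Dz _]; rewrite lee_fin mulr_ge0// poisson_kernel_ge0.
have mG := measurable_section_integral (@lebesgue_measure R) mDisk mI mf f0.
have := tonelli_on_sets (@lebesgue_measure R) muT mDisk mI mf f0.
set G := (fun x => integral _ _ _) in mG * => GE.
have G0 z : unit_disk R z -> (0 <= G z)%E.
  by move=> Dz; apply: integral_ge0 => t It; exact: f0.
have -> : Tint (fun t => `|w t / r|%:E * balayage mu t)%E =
    (c%:E * \int[mu]_(z in unit_disk R) G z)%E.
  rewrite GE /Tint -/c; congr (_ * _)%E; apply: eq_integral => t It.
  rewrite /balayage -ge0_integralZl//.
  - by apply: eq_integral => z _; rewrite /f/= -EFinM mulrC.
  - by apply/measurable_EFinP; exact: measurable_poisson_kernel_point.
  - by move=> z Dz; rewrite lee_fin poisson_kernel_ge0.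
move=> cG1.
have uG z : unit_disk R z -> ((u z)%:E <= (r * c)%:E * G z)%E.
  move=> Dz; apply: (le_trans (uw z Dz)).
  rewrite mulrC EFinM -muleA /poisson_int /Tint -/c.
  apply: lee_wpmul2l; first by rewrite lee_fin.
  have mP : measurable_fun (circle R) (fun t => (poisson_kernel z t * w t)%:E).
    apply/measurable_EFinP.
    by apply: measurable_funM => //; exact: measurable_poisson_kernel_angle.
  apply: (le_trans (lee_abs _)).
  apply: (le_trans (le_abse_integral (@lebesgue_measure R) mI mP)).
  rewrite -ge0_integralZl//; last 2 first.
  - apply/measurable_EFinP; apply: measurable_funM => //.
    exact: measurable_poisson_kernel_angle.
  - by move=> t It; rewrite (f0 (z, t)).
  rewrite le_eqVlt; apply/orP; left; apply/eqP; apply: eq_integral => t _.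
  rewrite /f/= -EFinM normrM (ger0_norm (poisson_kernel_ge0 t Dz)).
  rewrite normrM normfV (gtr0_norm rp); congr EFin.
  by rewrite [RHS]mulrC mulrA mulfVK// gt_eqF.
apply: (@le_trans _ _ (\int[mu]_(z in unit_disk R) ((r * c)%:E * G z))%E).
  apply: ge0_le_integral => //.
  - exact/measurable_EFinP.
  - exact: measurable_funeM.
rewrite ge0_integralZl//; last by rewrite lee_fin mulr_ge0.
rewrite EFinM -muleA -[leRHS]mule1.
by apply: lee_wpmul2l => //; rewrite lee_fin.
Qed.

(** * From the balayage bound to a Poisson majorant *)

(** A norm at most 1 only provides some admissible [t < r]. One factor [r] replaces [t] inside
    [psi]; the other is pulled out by convexity and turns the bound [t] on the modular into
    [t / r <= 1]. *)
Lemma orlicz_norm_ball (w : R -> R) (r : R) : in_orlicz phi w ->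
  (orlicz_norm psi w <= 1)%E -> 1 < r ->
  orlicz_ball (circle_measure R) (circle R) psi (fun t => `|w t| / r ^+ 2).
Proof.
move=> [mw _] w1 r1; have [_ psi0 psi_ge0 psi_convex] := psi_mod.
have rp : 0 < r by rewrite (lt_trans ltr01).
have : (orlicz_norm psi w < r%:E)%E by rewrite (le_lt_trans w1).
move=> /ereal_inf_lt[_ [t [t0 wt] <-]]; rewrite lte_fin => tr.
have mabs : measurable_fun (circle R) (fun s => `|w s|).
  exact: measurableT_comp.
have mdiv (x : R) : measurable_fun (circle R) (fun s => `|w s| / x).
  exact: measurable_funM.
have div0 (x : R) s : 0 < x -> 0 <= `|w s| / x.
  by move=> x0; rewrite divr_ge0// ltW.
have mpsi (x : R) : 0 < x ->
    measurable_fun (circle R) (fun s => (psi (`|w s| / x))%:E).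
  move=> x0; apply/measurable_EFinP.
  by apply: (gauge_measurable psi0 psi_ge0 psi_convex) => // s; exact: div0.
have r2 : 0 < r ^+ 2 by rewrite exprn_gt0.
split; [exact: mdiv | by move=> s; exact: div0 |].
move: wt; rewrite TintE; last 2 first.
- exact: mpsi.
- by move=> s _; rewrite lee_fin psi_ge0// div0.
move=> wt.
apply: (@le_trans _ _ (r^-1%:E * \int[circle_measure R]_(s in circle R)
    (psi (`|w s| / t))%:E)%E).
  rewrite -ge0_integralZl//; last 3 first.
  - exact: mpsi.
  - by move=> s _; rewrite lee_fin psi_ge0// div0.
  - by rewrite lee_fin invr_ge0 ltW.
  apply: ge0_le_integral => //.
  - by move=> s _; rewrite lee_fin psi_ge0// div0.
  - exact: mpsi.
  - by apply: measurable_funeM; exact: mpsi.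
  move=> s _; rewrite -EFinM lee_fin.
  have -> : `|w s| / r ^+ 2 = r^-1 * (`|w s| / r).
    by field; rewrite gt_eqF.
  have ri : 0 <= r^-1 <= 1 by rewrite invr_ge0 (ltW rp) invf_le1// ltW.
  apply: (le_trans (gauge_scale psi0 psi_convex ri (div0 r s rp))).
  rewrite ler_wpM2l ?invr_ge0 ?(ltW rp)//.
  apply: (gauge_le psi0 psi_ge0 psi_convex); first exact: div0.
  by rewrite ler_wpM2l// lef_pV2 ?posrE// ltW.
apply: (@le_trans _ _ (r^-1%:E * t%:E)%E).
  by apply: lee_wpmul2l => //; rewrite lee_fin invr_ge0 ltW.
by rewrite -EFinM lee_fin ler_pdivrMl// mulr1 ltW.
Qed.

(** Write [C * w] as [2 * C] times [w / 2], then apply [Delta2_scale] and compare [phi] with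
    [psi]. *)
Lemma in_orlicz_scale (C : R) (w : R -> R) : Delta2 phi -> 0 <= C ->
  measurable_fun (circle R) w -> (forall t, 0 <= w t) ->
  (\int[circle_measure R]_(t in circle R) (psi (2^-1 * w t))%:E <= 1)%E ->
  in_orlicz phi (fun t => C * w t).
Proof.
move=> D2 C0 mw w0 w1.
have [phi0 _ phi_nd _ _] := phi_sc.
have [_ psi0 psi_ge0 psi_convex] := psi_mod.
have mCw : measurable_fun (circle R) (fun t => C * w t).
  exact: measurable_funM.
have hw0 t : 0 <= 2^-1 * w t by rewrite mulr_ge0.
have mpsi : measurable_fun (circle R) (fun t => (psi (2^-1 * w t))%:E).
  apply/measurable_EFinP.
  by apply: (gauge_measurable psi0 psi_ge0 psi_convex) => //; exact: measurable_funM.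
have [c c0 hc] := le_modification phi_sc psi_mod.
have [a [b [a0 b0 hab]]] := Delta2_scale phi_sc D2 (mulr_ge0 (ler0n _ 2) C0).
have acb0 : 0 <= a * c + b by rewrite addr_ge0// mulr_ge0.
split=> //; rewrite Tint_phi//.
apply: (@le_lt_trans _ _ (\int[circle_measure R]_(t in circle R)
   (a%:E * (psi (2^-1 * w t))%:E + (a * c + b)%:E))%E).
  apply: ge0_le_integral => //.
  - by move=> t _; rewrite lee_fin.
  - exact: (mphi_abs mCw).
  - by apply: emeasurable_funD => //; exact: measurable_funeM.
  move=> t _; rewrite -EFinM -EFinD lee_fin ger0_norm ?mulr_ge0//.
  have -> : C * w t = 2 * C * (2^-1 * w t) by field.
  apply: (le_trans (hab _ (hw0 t))).
  have := ler_wpM2l a0 (hc _ (hw0 t)).1; lra.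
rewrite ge0_integralD//; last 2 first.
- by move=> t _; rewrite -EFinM lee_fin mulr_ge0// psi_ge0.
- exact: measurable_funeM.
rewrite ge0_integralZl//; last by move=> t _; rewrite lee_fin psi_ge0.
rewrite lte_add_pinfty//.
  by rewrite lte_mul_pinfty// (le_lt_trans w1)// ltry.
by rewrite integral_cst// lte_mul_pinfty// circle_measure_lty.
Qed.

Lemma majorant_of_balayage_bound (C : R) : Delta2 phi -> 0 <= C ->
  (forall mu : {measure set (R * R) -> \bar R}, B_phistar phi psi mu ->
     (\int[mu]_(z in unit_disk R) (u z)%:E <= C%:E)%E) ->
  exists w : R -> R, in_orlicz phi w /\
    forall z, unit_disk R z -> ((u z)%:E <= poisson_int w z)%E.
Proof.
move=> D2 C0 hC; have [_ psi0 psi_ge0 psi_convex] := psi_mod.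
have psi_super := modification_superlinear phi_sc psi_mod.
(* Indexing by the subtype makes the kernel bounds hold for every index. *)
pose X := {z : R * R | z \in unit_disk R}.
have Dval (x : X) : unit_disk R (val x) by have := valP x; rewrite inE.
(* [C1] is positive and strictly above [C], which gives the contradiction in [dual]. It is absorbed
   into the kernel [k] and returned to the majorant at the end. *)
pose C1 := C + 1; have C1p : 0 < C1 by rewrite ltr_wpDl.
pose k (x : X) t := C1 * poisson_kernel (val x) t.
pose M (x : X) := C1 * (4 / (1 - ((val x).1 ^+ 2 + (val x).2 ^+ 2))).
have k0 x t : 0 <= k x t by rewrite mulr_ge0 ?(ltW C1p)// poisson_kernel_ge0.
have kM x t : k x t <= M x by rewrite ler_wpM2l ?(ltW C1p)// poisson_kernel_le.
have mP (x : X) : measurable_fun (circle R) (poisson_kernel (val x)).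
  exact: measurable_poisson_kernel_angle.
have mk x : measurable_fun (circle R) (k x) by exact: measurable_funM.
have muI := circle_measure_lty R.
have mJ : measurable (circle R : set (measurableTypeR R)) by exact: mI.
pose m := circle_measure R.
pose ball := orlicz_ball m (circle R) psi.
pose v (x : X) := u (val x).
pose g (w : R -> R) (x : X) : R := \int[m]_(t in circle R) (k x t * w t).
have gint w x : ball w -> m.-integrable (circle R) (EFin \o (fun t => k x t * w t)).
  by move=> Kw; exact: (orlicz_ball_kernel_integrable mJ muI psi0 psi_ge0
    psi_convex psi_super (mk x) (k0 x) (kM x) Kw).
have ball0 : ball (fun=> 0) by exact: orlicz_ball0.
have g00 x : g (fun=> 0) x = 0.
  rewrite /g; under eq_Rintegral do rewrite mulr0.
  by rewrite Rintegral_cst// mul0r.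
(* If the weights [a] violate the dual inequality for all of [ball], the corresponding discrete
   measure, divided by [N], lies in [B_phistar] but violates the bound by [C]. *)
have dual (s : seq X) (a : X -> R) : (forall x, 0 <= a x) -> forall e, 0 < e ->
    exists2 w, ball w & \sum_(x <- s) a x * v x <= \sum_(x <- s) a x * g w x + e.
  move=> a0 e e0; apply: contrapT => no.
  set tau := \sum_(x <- s) a x * v x in no.
  have lt_tau w : ball w -> \sum_(x <- s) a x * g w x + e < tau.
    by move=> Kw; rewrite ltNge; apply/negP => h; apply: no; exists w.
  (* Testing with the zero function. *)
  have etau : e < tau.
    have := lt_tau _ ball0; rewrite big1 ?add0r// => x _.
    by rewrite g00 mulr0.
  pose N := (tau - e / 2) / C1.
  have Np : 0 < N by rewrite divr_gt0//; lra.
  have aN0 x : 0 <= a x / N by rewrite divr_ge0// ltW.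
  have [mu [muD muT muE]] := @exists_discrete_measure _ _ R (unit_disk R) X
    val (fun x => a x / N) s (@measurable_unit_disk R) Dval aN0.
  have muB : B_phistar phi psi mu.
    (* Norm at most 1 puts [w / rho] in [ball] only for [rho > 1]; the half of [e] kept in [N] pays
       for this [rho], since [rho / (N * C1)] is exactly [1 / (tau - e)]. *)
    split=> // w wL w1.
    pose rho := (tau - e / 2) / (tau - e).
    have te : 0 < tau - e by lra.
    have rho1 : 1 < rho by rewrite ltr_pdivlMr// mul1r; lra.
    pose r := Num.sqrt rho.
    have r2 : r ^+ 2 = rho by rewrite sqr_sqrtr// ltW// (lt_trans ltr01).
    have r1 : 1 < r by rewrite -sqrtr1 ltr_sqrt// (lt_trans ltr01).
    have := orlicz_norm_ball wL w1 r1; rewrite r2.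
    set y := (fun t => _ / rho) => Ky.
    have [my y0 _] := Ky.
    have wy t : `|w t| = rho * y t.
      by rewrite /y mulrC divfK// gt_eqF// (lt_trans ltr01).
    have bal t : circle R t ->
        balayage mu t = (\sum_(x <- s) a x / N * poisson_kernel (val x) t)%:E.
      move=> It; rewrite /balayage muE.
      - by rewrite -sumEFin; apply: eq_bigr => x _; rewrite EFinM.
      - by move=> z Dz; rewrite lee_fin poisson_kernel_ge0.
      apply/measurable_EFinP.
      exact: measurable_poisson_kernel_point.
    have mF (x : X) : measurable_fun (circle R)
        (fun t => (rho * (a x / N / C1))%:E * (k x t * y t)%:E)%E.
      by apply: measurable_funeM; apply/measurable_EFinP; exact: measurable_funM.
    have coef0 x : 0 <= rho * (a x / N / C1).
      have rho0 : 0 <= rho by rewrite ltW// (lt_trans ltr01).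
      by apply: mulr_ge0 => //; apply: divr_ge0; [exact: aN0 | exact: ltW].
    have F0 (x : X) t : circle R t ->
        (0 <= (rho * (a x / N / C1))%:E * (k x t * y t)%:E)%E.
      by move=> _; rewrite -EFinM lee_fin; apply: mulr_ge0 => //; apply: mulr_ge0.
    have wbE t : circle R t -> (`|w t|%:E * balayage mu t =
        \sum_(x <- s) (rho * (a x / N / C1))%:E * (k x t * y t)%:E)%E.
      move=> It; rewrite (bal t It) -EFinM mulr_sumr.
      under [RHS]eq_bigr do rewrite -EFinM.
      rewrite sumEFin; congr EFin; apply: eq_bigr => x _.
      by rewrite wy /k; field; rewrite !gt_eqF.
    have -> : Tint (fun t => `|w t|%:E * balayage mu t)%E =
       (\int[m]_(t in circle R)
         (\sum_(x <- s) (rho * (a x / N / C1))%:E * (k x t * y t)%:E))%E.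
      rewrite -TintE.
      - by rewrite /Tint; congr (_ * _)%E; apply: eq_integral => t;
          rewrite inE => It; exact: wbE.
      - exact: emeasurable_sum.
      - by move=> t It; apply: sume_ge0 => x _; exact: F0.
    rewrite ge0_integral_sum//.
    have -> : (\sum_(x <- s) \int[m]_(t in circle R)
          ((rho * (a x / N / C1))%:E * (k x t * y t)%:E))%E =
        (rho / (N * C1) * \sum_(x <- s) a x * g y x)%:E.
      rewrite mulr_sumr -sumEFin; apply: eq_bigr => x _.
      have mky : measurable_fun (circle R) (fun t => (k x t * y t)%:E).
        by apply/measurable_EFinP; exact: (measurable_funM (mk x) my).
      have ky0 t : circle R t -> (0 <= (k x t * y t)%:E)%E.
        by move=> _; rewrite lee_fin; exact: mulr_ge0.
      rewrite (ge0_integralZl m mJ mky ky0) ?lee_fin//.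
      have -> : (\int[m]_(t in circle R) (k x t * y t)%:E)%E = (g y x)%:E.
        by rewrite fineK//; apply: integrable_fin_num => //; exact: gint.
      by rewrite -EFinM; congr EFin; field; rewrite !gt_eqF.
    rewrite lee_fin.
    have NC : N * C1 = tau - e / 2 by rewrite /N divfK// gt_eqF.
    have te2 : 0 < tau - e / 2 by lra.
    have -> : rho / (N * C1) = (tau - e)^-1.
      by rewrite NC /rho mulrAC divff ?mul1r// gt_eqF.
    rewrite ler_pdivrMl// mulr1; have := lt_tau _ Ky; lra.
  have := hC mu muB; rewrite muE; last 2 first.
  - by move=> z Dz; rewrite lee_fin u0.
  - exact/measurable_EFinP.
  have -> : (\sum_(x <- s) (a x / N)%:E * (u (val x))%:E)%E = (tau / N)%:E.
    rewrite /tau mulr_suml -sumEFin; apply: eq_bigr => x _.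
    by rewrite -EFinM mulrAC.
  rewrite lee_fin ler_pdivrMr//.
  have -> : C * N = C * (tau - e / 2) / C1 by rewrite /N mulrA.
  rewrite ler_pdivlMr// /C1; nra.
have [B0 [B00 hB0]] := orlicz_ball_integral_le mJ muI psi0 psi_ge0 psi_convex
  psi_super.
have g_bounds w x : ball w -> 0 <= g w x <= M x * B0.
  move=> Kw; have [_ w0 _] := Kw; have Mx : 0 <= M x := le_trans (k0 x 0) (kM x 0).
  have iw : m.-integrable (circle R) (EFin \o w).
    exact: (orlicz_ball_integrable mJ muI psi0 psi_ge0 psi_convex psi_super Kw).
  apply/andP; split; first by apply: Rintegral_ge0 => t _; rewrite mulr_ge0.
  apply: (le_trans _ (ler_wpM2l Mx (hB0 _ Kw))).
  rewrite -RintegralZl//; apply: le_Rintegral => //.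
  - exact: gint.
  - exact: (integrableZl mJ (M x) iw).
  - by move=> t _; rewrite ler_wpM2r.
have fin (s : seq X) (e : R) : 0 < e -> exists2 w, ball w &
    forall x, x \in s -> v x - e <= g w x.
  (* On [ball] each [g w x] lies between 0 and [M x * B0], which bounds the squared distances
     required for separation. *)
  move=> e0; have [||||_ [w Kw <-] ws] := @convex_separation R X
    [set g w | w in ball] v s (\sum_(x <- s) (M x * B0) ^+ 2) _ _ _ _ e e0.
  - by exists (g (fun=> 0)), (fun=> 0).
  - move=> _ _ l [w Kw <-] [y Ky <-] l01.
    exists (fun t => l * w t + (1 - l) * y t).
      exact: orlicz_ball_convex.
    by apply/funext => x; exact: (orlicz_ball_kernel_convex mJ muI psi0 psi_ge0
      psi_convex psi_super (mk x) (k0 x) (kM x)).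
  - move=> _ _ [w Kw <-] [y Ky <-]; apply: ler_sum => x _.
    have /andP[gw0 gw1] := g_bounds w x Kw; have /andP[gy0 gy1] := g_bounds y x Ky.
    rewrite -[leLHS]real_normK ?num_real// ler_sqr ?nnegrE//; last first.
      exact: le_trans gw1.
    by rewrite ler_norml; apply/andP; split; lra.
  - move=> a a0 e' e'0; have [w Kw wa] := dual s a a0 e' e'0.
    by exists (g w) => //; exists w.
  by exists w.
(* The origin serves as the default index. *)
have D00 : (0, 0) \in unit_disk R.
  by rewrite inE /unit_disk/= expr0n/= addr0 ltr01.
have [w [mw w0 w1 wv]] := orlicz_ball_compact mJ muI psi0 psi_ge0 psi_convex
  psi_super (exist _ (0, 0) D00 : X) mk k0 kM fin.
exists (fun t => C1 * w t); split; first exact: (in_orlicz_scale D2 (ltW C1p)).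
move=> z Dz; have zD : z \in unit_disk R by rewrite inE.
have := wv (exist _ z zD : X); rewrite /v/= => /le_trans; apply.
rewrite -TintE.
- rewrite le_eqVlt; apply/orP; left; apply/eqP; congr Tint.
  by apply/funext => t; congr EFin; rewrite /k/=; ring.
- by apply/measurable_EFinP; exact: (measurable_funM (mk (exist _ z zD)) mw).
- by move=> t _; rewrite lee_fin mulr_ge0.
Qed.

End majorant.


(** * The equivalence *)

Theorem theorem1p2 (R : realType) (phi psi : R -> R) (u : R * R -> R) :
  strongly_convex phi -> Delta2 phi -> Nabla2 phi ->
  orlicz_modification phi psi ->
  measurable_fun (unit_disk R) u ->
  (forall z, unit_disk R z -> 0 <= u z) ->
  (exists w : R -> R, in_orlicz phi w /\
     forall z, unit_disk R z -> ((u z)%:E <= poisson_int w z)%E)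
  <->
  (exists C : R, 0 <= C /\
     forall mu : {measure set (R * R) -> \bar R}, B_phistar phi psi mu ->
       (\int[mu]_(z in unit_disk R) (u z)%:E <= C%:E)%E).
Proof.
move=> phi_sc D2 _ psi_mod mu_ u0; split=> [[w [wL uw]]|[C [C0 hC]]].
  exact: (balayage_bound_of_majorant phi_sc psi_mod mu_ u0 wL uw).
exact: (majorant_of_balayage_bound phi_sc psi_mod mu_ u0 D2 C0 hC).
Qed.
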